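(* Let $F=(N,F,\{F_\sigma\})$ be a KM fan, $\Lambda=\Lambda(F)$. Then $\mathbb U(F):=(\Lambda,\{i(\sigma):\sigma\in F\},\{i_\sigma(F_\sigma):\sigma\in F\})$ is a KM fan (the unfolding of $F$), and $\beta:\Lambda\to N$ defines a semi-tame morphism of KM fans $\beta:\mathbb U(F)\to F$ which is initial among all semi-tame morphisms with codomain $F$: for every semi-tame morphism $f:F'\to F$ there is a unique morphism $g:\mathbb U(F)\to F'$ with $fg=\beta$. If $F$ is atoroidal and $\operatorname{Ker}(\beta:\Lambda\to N)$ is torsion-free, then $\beta:\mathbb U(F)\to F$ is tame. The construction $F\mapsto\mathbb U(F)$ (together with $\beta$) is functorial in $F$ and takes semi-tame morphisms to isomorphisms. The rigidification of $\mathbb U(F)$ is $\mathbb U^{\rm rig}(F)=(\overline\Lambda,\{i(\sigma)\},\{\overline i_\sigma(F_\sigma)\})$ (the rigidified unfolding). Assume now $N$ is a lattice. Then $\overline\beta:\overline\Lambda\to N$ defines a semi-tame morphism $\overline\beta:\mathbb U^{\rm rig}(F)\to F$ which is initial among semi-tame morphisms $F'\to F$ with $F'$ a lattice KM fan; it is tame whenever $F$ is atoroidal. If $F$ is a classical fan, then $\mathbb U^{\rm rig}(F)$ is a classical fan.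
   Context: Notation: for an abelian group $N$, $N_{\mathbb R}=N\otimes\mathbb R$, $N_{\rm tor}$ its torsion subgroup, $\overline N=N/N_{\rm tor}$. A cone in $N_{\mathbb R}$ is $\{\sum\lambda_in_i:\lambda_i\ge0\}$ for finitely many $n_i\in N$; a fan in $N$ is a finite nonempty set of sharp cones closed under faces with pairwise intersections common faces; $N_\sigma=N\cap\operatorname{Span}\sigma$ (elements with image in the span). A KM fan $(N,F,\{F_\sigma\})$: a finitely generated abelian group $N$, a fan $F$ in $N$, and torsion-free finite-index subgroups $F_\sigma\subseteq N_\sigma$ with $F_\tau=F_\sigma\cap\operatorname{Span}\tau$ for faces $\tau\le\sigma$. Lattice KM fan: $N$ torsion-free; classical fan: lattice KM fan with $F_\sigma=N_\sigma$ for all $\sigma$. Morphism: homomorphism $f:N\to N'$ such that each $\sigma\in F$ has some $\tau\in F'$ with $f_{\mathbb R}(\sigma)\subseteq\tau$ and $f(F_\sigma)\subseteq F'_\tau$. A morphism $f$ is semi-tame if for every $\sigma\in F$, $\sigma':=f_{\mathbb R}(\sigma)\in F'$ and $f_{\mathbb R}|_\sigma:\sigma\to\sigma'$ is bijective, $\sigma\mapsto\sigma'$ is a bijection $F\to F'$, and $f|_{F_\sigma}:F_\sigma\to F'_{\sigma'}$ is bijective; it is tame if moreover $\operatorname{Cok}(f:N\to N')$ is finite and $\operatorname{Ker}f$ is torsion-free. $F$ is atoroidal if $\bigoplus_{\sigma\in F}\operatorname{Span}\sigma\to N_{\mathbb R}$ is surjective. The rigidification of a KM fan $F$ is $F^{\rm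 rig}=(\overline N,F,\{q(F_\sigma)\})$, $q:N\to\overline N$ the quotient (cones viewed in $\overline N_{\mathbb R}=N_{\mathbb R}$). Unfolding data: $\Lambda(F)=\varinjlim_{\sigma\in F}F_\sigma$, the colimit in abelian groups over the poset of cones with the inclusions $F_\tau\hookrightarrow F_\sigma$ for $\tau\le\sigma$; $i_\sigma:F_\sigma\to\Lambda$ the structure maps; $\overline\Lambda=\Lambda/\Lambda_{\rm tor}$ and $\overline i_\sigma$ the composite $F_\sigma\to\overline\Lambda$; $\beta:\Lambda\to N$ the map induced by the inclusions $F_\sigma\subseteq N$; when $N$ is a lattice, $\overline\beta:\overline\Lambda\to N$ the induced map. For $\sigma\in F$, $i(\sigma)\subseteq\Lambda_{\mathbb R}=\overline\Lambda_{\mathbb R}$ is the image of $\sigma\subseteq F_\sigma\otimes\mathbb R$ under $i_\sigma\otimes\mathbb R$. *)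

(* Defs.v *)
From HB Require Import structures.
From mathcomp Require Import all_boot all_order all_algebra.
From mathcomp Require Import boolp classical_sets cardinality reals.
Set Implicit Arguments. Unset Strict Implicit. Unset Printing Implicit Defensive.
Import Order.TTheory GRing.Theory Num.Theory.
Local Open Scope ring_scope.
Local Open Scope classical_set_scope.

Section KM.
Variable R : realType.

(* Model of N_R = N (x) R for a finitely generated abelian group N:
   N_R is identified with its image in the space of functions on
   Hom_Z(N,R) (= Hom_R(N_R,R)), n (x) r |-> (phi |-> r * phi n).
   Sets of N_R are sets of such functions. *)
Definition dualR (N : zmodType) := {additive N -> R}.
Definition VR (N : zmodType) := dualR N -> R.
Definition emb (N : zmodType) (n : N) : VR N := fun phi : dualR _ => phi n.

Definition rspan (N : zmodType) (S : set (VR N)) : set (VR N) :=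
  [set x | exists k (c : 'I_k -> R) (v : 'I_k -> VR N),
     (forall j, S (v j)) /\ x = fun phi : dualR _ => \sum_j c j * v j phi].

Definition cone_gen (N : zmodType) (G : seq N) : set (VR N) :=
  [set x | exists k (c : 'I_k -> R) (n : 'I_k -> N),
     (forall j, 0 <= c j /\ n j \in G) /\ x = fun phi : dualR _ => \sum_j c j * phi (n j)].
Definition is_cone (N : zmodType) (s : set (VR N)) := exists G : seq N, s = cone_gen G.
Definition sharp (N : zmodType) (s : set (VR N)) :=
  forall x, s x -> s (fun phi : dualR _ => - x phi) -> x = fun _ => 0.
(* t is a face of s: cut out by a supporting linear form (x u = <x,u>) *)
Definition is_face (N : zmodType) (t s : set (VR N)) :=
  exists u : dualR N, (forall x, s x -> 0 <= x u) /\ t = [set x | s x /\ x u = 0].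

Definition is_fan (N : zmodType) (F : set (set (VR N))) :=
  [/\ finite_set F, F !=set0,
      (forall s, F s -> is_cone s /\ sharp s),
      (forall s t, F s -> is_face t s -> F t) &
      (forall s t, F s -> F t -> is_face (s `&` t) s /\ is_face (s `&` t) t)].

Definition latt_of (N : zmodType) (s : set (VR N)) : set N := [set n | rspan s (emb n)].

Definition fingen (N : zmodType) :=
  exists k (g : 'I_k -> N), forall n, exists c : 'I_k -> int, n = \sum_j g j *~ c j.
Definition is_subgroup (N : zmodType) (A : set N) :=
  A 0 /\ (forall x y, A x -> A y -> A (x - y)).
Definition tfree (N : zmodType) (A : set N) :=
  forall x k, A x -> (0 < k)%N -> x *+ k = 0 -> x = 0.
Definition fin_index (N : zmodType) (A B : set N) :=
  exists k (r : 'I_k -> N), forall x, B x -> exists j, A (x - r j).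

Record KMfan := KMFan {
  kmN : zmodType;
  kmF : set (set (VR kmN));
  kmFs : set (VR kmN) -> set kmN }.
Arguments kmF : clear implicits.
Arguments kmFs : clear implicits.

Definition is_KM (K : KMfan) :=
  [/\ fingen (kmN K), is_fan (kmF K),
      (forall s, kmF K s ->
         [/\ is_subgroup (kmFs K s), kmFs K s `<=` latt_of s,
             tfree (kmFs K s) & fin_index (kmFs K s) (latt_of s)]) &
      (forall s t, kmF K s -> is_face t s -> kmFs K t = kmFs K s `&` latt_of t)].

Definition lattice_KM (K : KMfan) := is_KM K /\ tfree [set: kmN K].
Definition classical_fan (K : KMfan) :=
  lattice_KM K /\ forall s, kmF K s -> kmFs K s = latt_of s.

Definition fR (N N' : zmodType) (f : {additive N -> N'}) (x : VR N) : VR N' :=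
  fun psi => x (psi \o f).

Definition is_mor (K K' : KMfan) (f : {additive kmN K -> kmN K'}) :=
  forall s, kmF K s -> exists t, [/\ kmF K' t, fR f @` s `<=` t & f @` kmFs K s `<=` kmFs K' t].

Definition semitame (K K' : KMfan) (f : {additive kmN K -> kmN K'}) :=
  [/\ is_mor f,
      (forall s, kmF K s ->
         [/\ kmF K' (fR f @` s),
             (forall x y, s x -> s y -> fR f x = fR f y -> x = y),
             (forall x y, kmFs K s x -> kmFs K s y -> f x = f y -> x = y) &
             f @` kmFs K s = kmFs K' (fR f @` s)]),
      (forall s t, kmF K s -> kmF K t -> fR f @` s = fR f @` t -> s = t) &
      (forall t, kmF K' t -> exists s, kmF K s /\ fR f @` s = t)].

Definition tame (K K' : KMfan) (f : {additive kmN K -> kmN K'}) :=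
  [/\ semitame f,
      (exists k (r : 'I_k -> kmN K'), forall y, exists j x, y = r j + f x) &
      tfree [set x | f x = 0]].

Definition is_iso (K K' : KMfan) (f : {additive kmN K -> kmN K'}) :=
  is_mor f /\ exists g : {additive kmN K' -> kmN K},
    [/\ is_mor g, cancel f g & cancel g f].

Definition atoroidal (K : KMfan) :=
  forall n : kmN K, rspan (\bigcup_(s in kmF K) s) (emb n).

(* colimit Lambda(F) = colim_{sigma in F} F_sigma, given by its universal
   property; i s : F_s -> L (junk outside F_s). *)
Definition compat_fam (K : KMfan) (A : zmodType) (g : set (VR (kmN K)) -> kmN K -> A) :=
  (forall s, kmF K s -> forall x y, kmFs K s x -> kmFs K s y -> g s (x + y) = g s x + g s y) /\
  (forall s t, kmF K s -> is_face t s -> forall n, kmFs K t n -> g t n = g s n).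

Definition is_colim (K : KMfan) (L : zmodType) (i : set (VR (kmN K)) -> kmN K -> L) :=
  compat_fam i /\
  forall (A : zmodType) (g : set (VR (kmN K)) -> kmN K -> A), compat_fam g ->
    (exists h : {additive L -> A},
        forall s n, kmF K s -> kmFs K s n -> h (i s n) = g s n) /\
    (forall h1 h2 : {additive L -> A},
        (forall s n, kmF K s -> kmFs K s n -> h1 (i s n) = g s n) ->
        (forall s n, kmF K s -> kmFs K s n -> h2 (i s n) = g s n) ->
        forall y, h1 y = h2 y).

Definition is_beta (K : KMfan) (L : zmodType) (i : set (VR (kmN K)) -> kmN K -> L)
  (b : {additive L -> kmN K}) :=
  forall s n, kmF K s -> kmFs K s n -> b (i s n) = n.

(* i(s): image of s (inside F_s (x) R) under i_s (x) R; elements of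
   F_s (x) R are written as real combinations of elements of F_s. *)
Definition imcone (K : KMfan) (L : zmodType) (i : set (VR (kmN K)) -> kmN K -> L)
  (s : set (VR (kmN K))) : set (VR L) :=
  [set y | exists k (c : 'I_k -> R) (n : 'I_k -> kmN K),
     [/\ (forall j, kmFs K s (n j)),
         s (fun phi : dualR _ => \sum_j c j * phi (n j)) &
         y = fun psi : dualR _ => \sum_j c j * psi (i s (n j))]].

Definition unfold (K : KMfan) (L : zmodType) (i : set (VR (kmN K)) -> kmN K -> L) : KMfan :=
  @KMFan L [set r | exists s, kmF K s /\ r = imcone i s]
    (fun r => [set y | exists s, [/\ kmF K s, r = imcone i s &
                                   exists n, kmFs K s n /\ y = i s n]]).

Definition induces (K1 K2 : KMfan) (L1 L2 : zmodType)
  (i1 : set (VR (kmN K1)) -> kmN K1 -> L1) (i2 : set (VR (kmN K2)) -> kmN K2 -> L2)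
  (f : {additive kmN K1 -> kmN K2}) (u : {additive L1 -> L2}) :=
  forall s t, kmF K1 s -> kmF K2 t -> fR f @` s `<=` t -> f @` kmFs K1 s `<=` kmFs K2 t ->
    forall n, kmFs K1 s n -> u (i1 s n) = i2 t (f n).

Definition torsion_quot (L Lb : zmodType) (q : {additive L -> Lb}) :=
  (forall y, exists x, q x = y) /\
  (forall x, q x = 0 <-> exists k, (0 < k)%N /\ x *+ k = 0).

(* rigidification (Nbar, F, {q(F_s)}), cones transported along q_R *)
Definition rig (K : KMfan) (Nb : zmodType) (q : {additive kmN K -> Nb}) : KMfan :=
  @KMFan Nb [set r | exists s, kmF K s /\ r = fR q @` s]
    (fun r => [set y | exists s, [/\ kmF K s, r = fR q @` s &
                                   exists n, kmFs K s n /\ y = q n]]).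

End KM.

(* Main.v *)
(* The point is that beta, restricted to the real span of a cone of the
   unfolding, is injective. A linear form on F_sigma extends to N because R is
   divisible, so i_sigma (x) R identifies Span(sigma) with the span of i(sigma),
   with inverse beta_R. Faces, intersections, sharpness and lattices of i(sigma)
   are thus those of sigma, up to torsion of the finitely generated group Lambda
   (which dies in N_R); this only affects the finite index condition. All of
   this uses only that the i_sigma are compatible, split by beta and jointly
   generating, hence applies verbatim to Lambda modulo torsion. Initiality comes
   from the colimit: over a semi-tame f, the maps F_sigma -> F'_sigma' inverse to
   f form a cocone; uniqueness holds because f is faithful on morphisms. *)
Require Import Defs.
From HB Require Import structures.
From mathcomp Require Import all_boot all_order all_algebra.
From mathcomp Require Import boolp classical_sets cardinality reals.
Import Order.TTheory GRing.Theory Num.Theory.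
Local Open Scope ring_scope.
Local Open Scope classical_set_scope.

Set Implicit Arguments.
Unset Strict Implicit.
Unset Printing Implicit Defensive.

(** * Additive maps and subgroups *)

Lemma additive_eq (U V : zmodType) (f g : {additive U -> V}) : f =1 g -> f = g.
Proof.
case: f g => [f [[cf]]] [g [[cg]]] /= /funext fg; move: fg cf cg => -> cf cg.
by rewrite (Prop_irrelevance cf cg).
Qed.

Lemma additive_of (U V : zmodType) (h : U -> V) :
  (forall x y, h (x - y) = h x - h y) -> exists f : {additive U -> V}, f =1 h.
Proof.
move=> hB.
pose h_additive := GRing.isZmodMorphism.Build U V h hB.
by exists (HB.pack_for {additive U -> V} h h_additive).
Qed.

Section Subgroup.
Variables (N : zmodType) (A : set N).
Hypothesis sgA : is_subgroup A.

Lemma subgroup0 : A 0. Proof. by case: sgA. Qed.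

Lemma subgroupB x y : A x -> A y -> A (x - y).
Proof. by case: sgA => _; apply. Qed.

Lemma subgroupN x : A x -> A (- x).
Proof. by move=> Ax; rewrite -sub0r; apply: subgroupB => //; apply: subgroup0. Qed.

Lemma subgroupD x y : A x -> A y -> A (x + y).
Proof. by move=> Ax Ay; rewrite -[y]opprK; apply/subgroupB/subgroupN. Qed.

Lemma subgroupMn x k : A x -> A (x *+ k).
Proof.
move=> Ax; elim: k => [|k IH]; first by rewrite mulr0n; apply: subgroup0.
by rewrite mulrS; apply: subgroupD.
Qed.

Lemma subgroupMz x m : A x -> A (x *~ m).
Proof.
move=> Ax; case: m => k; first exact: subgroupMn.
by rewrite NegzE mulrNz; apply/subgroupN/subgroupMn.
Qed.

Lemma subgroup_sum k (v : 'I_k -> N) : (forall j, A (v j)) -> A (\sum_j v j).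
Proof. by move=> Av; apply: big_ind => //; [exact: subgroup0|exact: subgroupD]. Qed.

Section AdditiveOn.
Variables (V : zmodType) (g : N -> V).
Hypothesis gD : forall x y, A x -> A y -> g (x + y) = g x + g y.

Lemma additive_on0 : g 0 = 0.
Proof. by apply: (addIr (g 0)); rewrite -gD ?addr0 ?add0r //; apply: subgroup0. Qed.

Lemma additive_onB x y : A x -> A y -> g (x - y) = g x - g y.
Proof. by move=> Ax Ay; apply/eqP; rewrite eq_sym subr_eq -gD ?subrK//; apply: subgroupB. Qed.

Lemma additive_onN x : A x -> g (- x) = - g x.
Proof. by move=> Ax; rewrite -sub0r additive_onB ?additive_on0 ?sub0r//; apply: subgroup0. Qed.

Lemma additive_onMn x k : A x -> g (x *+ k) = g x *+ k.
Proof.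
move=> Ax; elim: k => [|k IH]; first by rewrite !mulr0n additive_on0.
by rewrite !mulrS gD ?IH//; apply: subgroupMn.
Qed.

Lemma additive_onMz x m : A x -> g (x *~ m) = g x *~ m.
Proof.
move=> Ax; case: m => k; first exact: additive_onMn.
by rewrite NegzE !mulrNz additive_onN ?additive_onMn//; apply: subgroupMn.
Qed.

End AdditiveOn.

End Subgroup.

Lemma is_subgroupT (N : zmodType) : is_subgroup [set: N]. Proof. by []. Qed.

Lemma is_subgroup1 (N : zmodType) : is_subgroup [set (0 : N)].
Proof. by split=> [//|x y -> ->]; rewrite subr0. Qed.

Lemma is_subgroup_image (M N : zmodType) (f : {additive M -> N}) (A : set M) :
  is_subgroup A -> is_subgroup (f @` A).
Proof.
move=> sgA; split; first by exists 0; [exact: subgroup0|rewrite raddf0].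
by move=> _ _ [x Ax <-] [y Ay <-]; exists (x - y); [exact: subgroupB|rewrite raddfB].
Qed.

Lemma is_subgroup_preimage (M N : zmodType) (A : set M) (g : M -> N) (P : set N) :
    is_subgroup A -> (forall x y, A x -> A y -> g (x + y) = g x + g y) -> is_subgroup P ->
  is_subgroup [set x | A x /\ P (g x)].
Proof.
move=> sgA gD sgP; split=> [|x y [Ax Px] [Ay Py]].
  by split; [exact: subgroup0|rewrite (additive_on0 sgA gD); exact: subgroup0].
by split; [exact: subgroupB|rewrite (additive_onB sgA gD)//; exact: subgroupB].
Qed.

Definition adjoin (N : zmodType) (A : set N) (x : N) : set N :=
  [set y | exists a m, A a /\ y = a + x *~ m].

Section Adjoin.
Variables (N : zmodType) (A : set N) (x : N).
Hypothesis sgA : is_subgroup A.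

Lemma is_subgroup_adjoin : is_subgroup (adjoin A x).
Proof.
split; first by exists 0, 0; split; [exact: subgroup0|rewrite mulr0z addr0].
move=> _ _ [a [m [Aa ->]]] [a' [m' [Aa' ->]]]; exists (a - a'), (m - m').
by split; [exact: subgroupB|rewrite mulrzBr opprD addrACA].
Qed.

Lemma sub_adjoin : A `<=` adjoin A x.
Proof. by move=> a Aa; exists a, 0; rewrite mulr0z addr0. Qed.

Lemma mem_adjoin : adjoin A x x.
Proof. by exists 0, 1; split; [exact: subgroup0|rewrite add0r]. Qed.

Lemma adjoin_min (P : set N) : is_subgroup P -> A `<=` P -> P x -> adjoin A x `<=` P.
Proof.
by move=> sgP AP Px _ [a [m [/AP Pa ->]]]; apply: subgroupD => //; apply: subgroupMz.
Qed.

(** The only obstruction to giving the new generator [x] the value [v] lies in the overlap of [A]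
    with the multiples of [x]; the second hypothesis removes it. *)
Lemma extend_adjoin (V : zmodType) (g : N -> V) (v : V) :
    (forall a a', A a -> A a' -> g (a + a') = g a + g a') ->
    (forall m, A (x *~ m) -> g (x *~ m) = v *~ m) ->
  exists h : N -> V,
    [/\ forall y y', adjoin A x y -> adjoin A x y' -> h (y + y') = h y + h y',
        forall a, A a -> h a = g a & h x = v].
Proof.
move=> gD gx.
(* [h] evaluates some decomposition of [y], with default 0 off [adjoin A x]. The choice is harmless
   ([hE]): two decompositions differ by a multiple of [x] lying in [A]. *)
have /choice[h hP] y : exists w, adjoin A x y ->
    exists a m, [/\ A a, y = a + x *~ m & w = g a + v *~ m].
  have [[a [m [Aa ->]]]|nAy] := pselect (adjoin A x y); last by exists 0.
  by exists (g a + v *~ m) => _; exists a, m.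
have hE a m : A a -> h (a + x *~ m) = g a + v *~ m.
  move=> Aa; have [|a' [m' [Aa' e ->]]] := hP (a + x *~ m); first by exists a, m.
  have e' : a' - a = x *~ (m - m').
    by rewrite mulrzBr; apply/eqP; rewrite subr_eq addrAC eq_sym subr_eq [_ + a]addrC e.
  have := gx (m - m'); rewrite -e' => /(_ (subgroupB sgA Aa' Aa)).
  rewrite (additive_onB sgA gD)// mulrzBr => /eqP; rewrite subr_eq => /eqP ->.
  by rewrite addrAC subrK addrC.
exists h; split.
- move=> _ _ [a [m [Aa ->]]] [a' [m' [Aa' ->]]].
  rewrite addrACA -mulrzDr (hE _ _ (subgroupD sgA Aa Aa')) (hE _ _ Aa) (hE _ _ Aa').
  by rewrite mulrzDr (gD _ _ Aa Aa') addrACA.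
- by move=> a Aa; rewrite -[a in LHS]addr0 -(mulr0z x) hE// mulr0z addr0.
- rewrite -[x in LHS]add0r -[x in LHS]mulr1z hE; last exact: subgroup0.
  by rewrite (additive_on0 sgA gD) add0r mulr1z.
Qed.

End Adjoin.

(** * Finitely generated abelian groups *)

(** Recursive, so that induction on the list adjoins one generator at a time. *)
Definition zspan (N : zmodType) (l : seq N) : set N :=
  foldr (fun x A => adjoin A x) [set 0] l.

Section Zspan.
Variables (N : zmodType).
Implicit Types (l : seq N) (P : set N).

Lemma is_subgroup_zspan l : is_subgroup (zspan l).
Proof.
elim: l => [|x l IH]; first exact: is_subgroup1.
exact: is_subgroup_adjoin.
Qed.

Lemma mem_zspan l x : x \in l -> zspan l x.
Proof.
elim: l => [//|y l IH]; rewrite inE => /predU1P[->|/IH lx].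
  exact/mem_adjoin/is_subgroup_zspan.
exact: sub_adjoin.
Qed.

Lemma zspan_min l P : is_subgroup P -> (forall x, x \in l -> P x) -> zspan l `<=` P.
Proof.
move=> sgP; elim: l => [|x l IH] lP; first by move=> _ ->; apply: subgroup0.
apply: adjoin_min => //; last by apply: lP; rewrite mem_head.
by apply: IH => y ly; apply: lP; rewrite inE ly orbT.
Qed.

Lemma fingenP : fingen N <-> exists l : seq N, forall x, zspan l x.
Proof.
split=> [[k [g gP]]|[l lP]].
  exists (codom g) => x; have [c ->] := gP x.
  apply: (subgroup_sum (is_subgroup_zspan _)) => j.
  by apply: subgroupMz; [exact: is_subgroup_zspan|exact/mem_zspan/codom_f].
exists (size l), (fun j => l`_j) => n.
pose P := [set y | exists c : 'I_(size l) -> int, y = \sum_(j < size l) l`_j *~ c j].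
apply: (@zspan_min l P _ _ n (lP n)) => [|x /(nthP 0)[j jl <-]].
  split; first by exists (fun=> 0); rewrite big1.
  move=> _ _ [c ->] [d ->]; exists (fun j => c j - d j).
  by rewrite -sumrB; apply: eq_bigr => j _; rewrite mulrzBr.
exists (fun k => (k == Ordinal jl)%:Z).
rewrite (bigD1 (Ordinal jl))//= eqxx mulr1z big1 ?addr0// => k /negbTE ->.
by rewrite mulr0z.
Qed.

(* The coefficients of x occurring in A form an ideal of Z; a generator of
   it yields the one new generator of A. *)
Lemma subgroup_fingen l A : is_subgroup A -> A `<=` zspan l ->
  exists l', (forall x, x \in l' -> A x) /\ A `<=` zspan l'.
Proof.
elim: l A => [|x l IH] A sgA Al; first by exists [::].
have sgl := is_subgroup_zspan l.
pose I (m : int) := exists2 a, A a & exists2 z, zspan l z & a = z + x *~ m.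
have IB m m' : I m -> I m' -> I (m - m').
  move=> [a Aa [z lz ea]] [a' Aa' [z' lz' ea']]; exists (a - a'); first exact: subgroupB.
  by exists (z - z'); [exact: subgroupB|rewrite ea ea' mulrzBr opprD addrACA].
have I0 : I 0.
  exists 0; first exact: subgroup0.
  by exists 0; [exact: subgroup0|rewrite mulr0z addr0].
have sgI : is_subgroup (I : set int) by split.
have sgAl : is_subgroup (A `&` zspan l).
  by split=> [|y y' [? ?] [? ?]]; split; (exact: subgroup0 || exact: subgroupB).
have [l' [Al' l'P]] := IH (A `&` zspan l) sgAl (@subIsetr _ _ _).
(* Without a positive coefficient the ideal [I] is zero, so [A] lies in [zspan l] and [l']
   suffices. *)
have [[d0 d0P]|noI] := pselect (exists d : nat, (0 < d)%N /\ I d%:Z); last first.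
  exists l'; split=> [y /Al'[]//|a Aa]; apply: l'P; split => //.
  have [z [m [lz ea]]] := Al a Aa; suff m0 : m = 0 by rewrite ea m0 mulr0z addr0.
  have Im : I m by exists a => //; exists z.
  case: m Im {ea} => [[//|m]|m] Im; first by case: noI; exists m.+1.
  by case: noI; exists m.+1; split=> //; rewrite -[Posz _]opprK -NegzE; apply: subgroupN.
have exd : exists d : nat, (0 < d)%N && `[<I d%:Z>].
  by exists d0; case: d0P => -> ?; apply/asboolP.
have [d /andP[d_gt0 /asboolP[a Aa [z lz ea]]] dmin] := ex_minnP exd.
exists (a :: l'); split=> [y|a' Aa'].
  by rewrite inE => /predU1P[->//|/Al'[]].
have [z' [m [lz' ea']]] := Al a' Aa'.
have Im : I m by exists a' => //; exists z'.
have dn0 : d%:Z != 0 by rewrite -lt0n.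
(* The remainder is a coefficient below the least positive one [d], hence zero; subtracting a
   multiple of [a] from [a'] then lands in [zspan l]. *)
have Ir : I (m %% d)%Z.
  rewrite /modz; apply: IB => //.
  rewrite mulrC -mulrzz; apply: (subgroupMz sgI).
  by exists a => //; exists z.
have r0 : (m %% d)%Z = 0.
  have := ltz_mod m dn0; have := modz_ge0 m dn0.
  case: (m %% d)%Z Ir => // -[//|r] Ir _ rd.
  have := dmin r.+1; rewrite andTb; case: asboolP => // _ /(_ isT).
  by rewrite leqNgt; move: rd; rewrite ltz_nat /= => ->.
exists (a' - a *~ (m %/ d)%Z), (m %/ d)%Z; split; last by rewrite subrK.
apply: l'P; split; first by apply: subgroupB => //; apply: subgroupMz.
have em : m = (m %/ d)%Z * d by rewrite {1}(divz_eq m d) r0 addr0.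
rewrite ea' ea mulrzDl -mulrzA [_ * (m %/ d)%Z]mulrC -em opprD addrACA subrr addr0.
by apply: subgroupB => //; apply: subgroupMz.
Qed.

(** Reducing the coefficient of each generator [x] modulo some [k] with [x *+ k] in [A] leaves
    finitely many representatives. *)
Lemma zspan_fin_index l A B : is_subgroup A -> B `<=` zspan l ->
    (forall x, x \in l -> exists2 k, (0 < k)%N & A (x *+ k)) ->
  fin_index A B.
Proof.
move=> sgA Bl lA.
suff [r rP] : exists r : seq N, forall x, zspan l x -> exists2 y, y \in r & A (x - y).
  exists (size r), (fun j => r`_j) => x /Bl/rP[y yr Ay].
  have yi : (index y r < size r)%N by rewrite index_mem.
  by exists (Ordinal yi); rewrite /= nth_index.
elim: l lA {Bl B} => [|x l IH] lA.
  by exists [:: 0] => _ ->; exists 0; rewrite ?mem_head ?subr0//; apply: subgroup0.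
have [|r rP] := IH; first by move=> y ly; apply: lA; rewrite inE ly orbT.
have [k k_gt0 Ak] := lA x (mem_head _ _).
exists [seq y + x *+ m | y <- r, m <- iota 0 k] => _ [z [m [/rP[y yr Ay] ->]]].
have kn0 : k%:Z != 0 by case: k k_gt0 {Ak}.
have := ltz_mod m kn0; have := modz_ge0 m kn0; have := divz_eq m k.
case: (m %% k)%Z => // j em _ jk; exists (y + x *+ j).
  by apply: allpairs_f => //; rewrite mem_iota.
rewrite em mulrzDr [_ * k%:Z]mulrC mulrzA addrA [y + _]addrC addrKA addrAC.
by apply: subgroupD => //; apply: subgroupMz.
Qed.

End Zspan.

(** Pigeonhole: among the multiples of [x] from 0 to [k], two share one of the [k]
    representatives. *)
Lemma fin_index_mulrn (N : zmodType) (A B : set N) x :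
  is_subgroup A -> is_subgroup B -> fin_index A B -> B x ->
  exists2 k, (0 < k)%N & A (x *+ k).
Proof.
move=> sgA sgB [k [r rP]] Bx.
have /choice[c cP] (m : 'I_k.+1) : exists j, A (x *+ m - r j).
  by apply: rP; apply: subgroupMn.
have /injectivePn[m1 [m2 m12 cm12]] : ~~ injectiveb c.
  by apply/negP => /injectiveP/leq_card; rewrite !card_ord ltnn.
wlog lt12 : m1 m2 m12 cm12 / (m1 < m2)%N.
  by move=> W; case: (ltngtP m1 m2) => [|/W|/val_inj e];
    [exact: W|apply; rewrite // eq_sym|rewrite e eqxx in m12].
exists (m2 - m1)%N; first by rewrite subn_gt0.
rewrite mulrnBr ?(ltnW lt12)//.
have := subgroupB sgA (cP m2) (cP m1).
by rewrite cm12 opprB addrA subrK.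
Qed.

(** * Real-valued homomorphisms on finitely generated groups *)

(** Starting from [A], the generators of [N] are adjoined one by one; divisibility of [R] supplies a
    value at each. *)
Lemma extend_real (R : realType) (N : zmodType) (A : set N) (g : N -> R) :
    fingen N -> is_subgroup A -> (forall x y, A x -> A y -> g (x + y) = g x + g y) ->
  exists phi : dualR R N, forall a, A a -> phi a = g a.
Proof.
move=> /fingenP[l lP] sgA gD.
suff [B [h [sgB AB lB hD hg]]] : exists (B : set N) (h : N -> R),
    [/\ is_subgroup B, A `<=` B, forall x, x \in l -> B x,
       forall x y, B x -> B y -> h (x + y) = h x + h y & forall a, A a -> h a = g a].
  have BT x : B x by apply: (zspan_min sgB lB).
  have [phi phiE] : exists phi : {additive N -> R}, phi =1 h.
    by apply: additive_of => x y; apply: (additive_onB sgB hD).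
  by exists phi => a Aa; rewrite phiE hg.
elim: l {lP} => [|x l [B [h [sgB AB lB hD hg]]]]; first by exists A, g; split.
(* If [x *+ k] is in [B] for some positive [k], its value divided by [k] is forced at [x]; otherwise
   only the zero multiple of [x] meets [B], and 0 will do. *)
have [v vP] : exists v, forall m, B (x *~ m) -> h (x *~ m) = v *~ m.
  have [[k k_gt0 Bk]|nB] := pselect (exists2 k, (0 < k)%N & B (x *+ k)).
    have kn0 : k%:R != 0 :> R by rewrite pnatr_eq0 -lt0n.
    exists (h (x *+ k) / k%:R) => m Bm; apply: (mulIf kn0).
    rewrite -mulrzAl divfK// mulr_natr -(additive_onMn sgB hD)//.
    by rewrite -(additive_onMz sgB hD)// !pmulrn mulrzAC.
  exists 0 => m Bm; suff -> : m = 0 by rewrite !mulr0z (additive_on0 sgB hD).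
  case: m Bm => [[//|m]|m] Bm; case: nB; exists m.+1 => //.
  by move: Bm; rewrite NegzE mulrNz => /(subgroupN sgB); rewrite opprK.
have [h' [h'D h'h _]] := extend_adjoin sgB hD vP.
exists (adjoin B x), h'; split=> //.
- exact: is_subgroup_adjoin.
- by move=> a /AB; apply: sub_adjoin.
- move=> y; rewrite inE => /predU1P[->|/lB]; [exact: mem_adjoin|exact: sub_adjoin].
- by move=> a Aa; rewrite h'h ?hg//; apply: AB.
Qed.

(** * Real spans *)

Section RealSpan.
Variable R : realType.
Implicit Types M N P : zmodType.

Lemma rspan_sub N (S : set (VR R N)) : S `<=` rspan S.
Proof.
move=> x Sx; exists 1%N, (fun=> 1), (fun=> x); split=> //.
by apply/funext => phi; rewrite big_ord1 mul1r.
Qed.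

Lemma rspanD N (S : set (VR R N)) x y :
  rspan S x -> rspan S y -> rspan S (fun phi => x phi + y phi).
Proof.
move=> [k [c [v [Sv ->]]]] [k' [c' [v' [Sv' ->]]]].
exists (k + k')%N,
  (fun j => match split j with inl j1 => c j1 | inr j2 => c' j2 end),
  (fun j => match split j with inl j1 => v j1 | inr j2 => v' j2 end).
split=> [j|]; first by case: (split j).
apply/funext => phi; rewrite big_split_ord /=; congr (_ + _).
- by apply: eq_bigr => j _; rewrite (unsplitK (inl j)).
- by apply: eq_bigr => j _; rewrite (unsplitK (inr j)).
Qed.

Lemma rspanZ N (S : set (VR R N)) a x : rspan S x -> rspan S (fun phi => a * x phi).
Proof.
move=> [k [c [v [Sv ->]]]]; exists k, (fun j => a * c j), v; split=> //.
by apply/funext => phi; rewrite mulr_sumr; apply: eq_bigr => j _; rewrite mulrA.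
Qed.

Lemma rspan0 N (S : set (VR R N)) : rspan S (fun=> 0).
Proof.
exists 0%N, (fun=> 0), (fun=> fun=> 0); split=> [[]//|].
by apply/funext => phi; rewrite big_ord0.
Qed.

Lemma rspan_lincomb N (S : set (VR R N)) k (c : 'I_k -> R) (v : 'I_k -> VR R N) :
  (forall j, rspan S (v j)) -> rspan S (fun phi => \sum_j c j * v j phi).
Proof.
elim: k c v => [|k IH] c v Sv.
  suff -> : (fun phi => \sum_j c j * v j phi) = fun=> 0 by exact: rspan0.
  by apply/funext => phi; rewrite big_ord0.
suff -> : (fun phi => \sum_j c j * v j phi) =
    fun phi => c ord0 * v ord0 phi + \sum_j c (lift ord0 j) * v (lift ord0 j) phi.
  by apply: rspanD; [exact: rspanZ|apply: (IH (c \o lift ord0) (v \o lift ord0)) => j; apply: Sv].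
by apply/funext => phi; rewrite big_ord_recl.
Qed.

Lemma rspan_min N (S T : set (VR R N)) : S `<=` rspan T -> rspan S `<=` rspan T.
Proof. by move=> ST x [k [c [v [Sv ->]]]]; apply: rspan_lincomb => j; apply/ST. Qed.

Lemma rspan_mono N (S T : set (VR R N)) : S `<=` T -> rspan S `<=` rspan T.
Proof. by move=> ST; apply: rspan_min => x /ST; apply: rspan_sub. Qed.

Lemma rspan_fR M N (f : {additive M -> N}) (S : set (VR R M)) :
  rspan (fR f @` S) = fR f @` rspan S.
Proof.
apply/seteqP; split=> [_ [k [c [v [Sv ->]]]]|_ [_ [k [c [v [Sv ->]]]] <-]].
  have /choice[w wP] j : exists w, S w /\ fR f w = v j.
    by have [w Sw <-] := Sv j; exists w.
  exists (fun phi => \sum_j c j * w j phi).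
    by exists k, c, w; split=> // j; case: (wP j).
  by apply/funext => phi; apply: eq_bigr => j _; case: (wP j) => _ <-.
by exists k, c, (fun j => fR f (v j)); split=> // j; exists (v j).
Qed.

Lemma fR_comp M N P (f : {additive M -> N}) (g : {additive N -> P}) (h : {additive M -> P}) :
  (forall x, g (f x) = h x) -> forall x : VR R M, fR g (fR f x) = fR h x.
Proof. by move=> gf x; apply/funext => psi; congr (x _); apply: additive_eq => y /=; rewrite gf. Qed.

Lemma fR_id N (f : {additive N -> N}) : (forall x, f x = x) -> forall x : VR R N, fR f x = x.
Proof. by move=> f_id x; apply/funext => psi; congr (x _); apply: additive_eq => y /=; rewrite f_id. Qed.

(** In the model [VR] this is the image of [A] tensored with the reals. *)
Definition lspan N (A : set N) : set (VR R N) := rspan (@emb R N @` A).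

Lemma lspan_emb N (A : set N) n : A n -> lspan A (@emb R N n).
Proof. by move=> An; apply: rspan_sub; exists n. Qed.

Lemma lspan_mono N (A B : set N) : A `<=` B -> lspan A `<=` lspan B.
Proof. by move=> AB; apply: rspan_mono => _ [n /AB Bn <-]; exists n. Qed.

Lemma lspanP N (A : set N) (x : VR R N) : lspan A x <->
  exists k (c : 'I_k -> R) (n : 'I_k -> N),
    (forall j, A (n j)) /\ x = fun phi : dualR R N => \sum_j c j * phi (n j).
Proof.
split=> [[k [c [v [Sv ->]]]]|[k [c [n [An ->]]]]]; last first.
  by exists k, c, (fun j => @emb R N (n j)); split=> // j; exists (n j).
have /choice[n nP] j : exists n, A n /\ @emb R N n = v j by have [n ? <-] := Sv j; exists n.
exists k, c, n; split=> [j|]; first by case: (nP j).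
by apply/funext => phi; apply: eq_bigr => j _; case: (nP j) => _ <-.
Qed.

Lemma lspan_fR M N (f : {additive M -> N}) (A : set M) :
  lspan (f @` A) = fR f @` lspan A.
Proof. by rewrite /lspan -rspan_fR !image_comp. Qed.

(** If no positive multiple of [n] were in [A], some real form on [N] would vanish on [A] and be 1
    at [n], which keeps [n] out of the real span of [A]. *)
Lemma lspan_mulrn N (A : set N) n : fingen N -> is_subgroup A -> lspan A (@emb R N n) ->
  exists2 k, (0 < k)%N & A (n *+ k).
Proof.
move=> fgN sgA /lspanP[k [c [m [Am en]]]]; apply: contrapT => nA.
have n0 p : A (n *~ p) -> p = 0.
  case: p => [[//|p]|p] Ap; case: nA; exists p.+1 => //.
  by move: Ap; rewrite NegzE mulrNz => /(subgroupN sgA); rewrite opprK.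
have [| |h [hD h0 hn]] := @extend_adjoin N A n sgA R (fun=> 0) 1.
- by move=> *; rewrite addr0.
- by move=> p /n0 ->; rewrite mulr0z.
have [phi phiE] := extend_real fgN (is_subgroup_adjoin n sgA) hD.
have := congr1 (fun x => x phi) en; rewrite /emb phiE ?hn; last exact: mem_adjoin.
rewrite big1 => [/eqP|j _]; first by rewrite oner_eq0.
by rewrite phiE ?h0 ?mulr0//; apply: sub_adjoin.
Qed.

Lemma lspan_mulrnW N (A : set N) n k : (0 < k)%N -> A (n *+ k) -> lspan A (@emb R N n).
Proof.
move=> k_gt0 Ank; have kn0 : k%:R != 0 :> R by rewrite pnatr_eq0 -lt0n.
suff -> : @emb R N n = fun phi => k%:R^-1 * emb (n *+ k) phi by apply/rspanZ/lspan_emb.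
by apply/funext => phi; rewrite /emb raddfMn -[phi n *+ k]mulr_natl mulKf.
Qed.

(** The zero subgroup in [lspan_mulrn]: passing to [VR] kills only torsion. *)
Lemma emb_eq0 N (n : N) : fingen N -> @emb R N n = (fun=> 0) ->
  exists2 k, (0 < k)%N & n *+ k = 0.
Proof.
move=> fgN n0; apply: (lspan_mulrn fgN (@is_subgroup1 N)).
by rewrite n0; apply: rspan0.
Qed.

(* Injectivity of f on A makes A embed in N, so that linear forms on A
   extend along f to N by divisibility of R. *)
Lemma dual_extend M N (f : {additive M -> N}) (A : set M) (w : dualR R M) :
    fingen N -> is_subgroup A -> (forall x y, A x -> A y -> f x = f y -> x = y) ->
  exists phi : dualR R N, forall x, lspan A x -> x w = fR f x phi.
Proof.
move=> fgN sgA f_inj.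
have /choice[g gP] y : exists r, forall a, A a -> f a = y -> w a = r.
  have [[a [Aa fa]]|nA] := pselect (exists a, A a /\ f a = y).
    by exists (w a) => a' Aa' fa'; congr (w _); apply: f_inj; rewrite ?fa.
  by exists 0 => a Aa fa; case: nA; exists a.
have gE a : A a -> g (f a) = w a by move=> Aa; rewrite (gP (f a) a).
have [|phi phiE] := extend_real (g := g) fgN (is_subgroup_image f sgA).
  move=> _ _ [x Ax <-] [y Ay <-]; rewrite -raddfD !gE ?raddfD//.
  exact: subgroupD.
exists phi => x /lspanP[k [c [n [An ->]]]]; apply: eq_bigr => j _.
by rewrite /= phiE ?gE//; exists (n j).
Qed.

(** Flatness of the reals in dual form: elements of [VR] are determined by their values on forms,
    and on the span of [A] every form is pulled back along [f]. *)
Lemma fR_inj M N (f : {additive M -> N}) (A : set M) x y :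
    fingen N -> is_subgroup A -> (forall x y, A x -> A y -> f x = f y -> x = y) ->
  lspan A x -> lspan A y -> fR f x = fR f y -> x = y.
Proof.
move=> fgN sgA f_inj Ax Ay fxy; apply/funext => w.
by have [phi phiE] := dual_extend w fgN sgA f_inj; rewrite !phiE// fxy.
Qed.

End RealSpan.

(** * Cones and KM fans *)

Notation Fan K := (@kmF _ K).
Notation Lat K := (@kmFs _ K).

Section Cones.
Variables (R : realType) (N : zmodType).
Implicit Types (s t : set (VR R N)) (G : seq N).

Lemma mem_cone_gen G n : n \in G -> cone_gen G (@emb R N n).
Proof.
move=> Gn; exists 1%N, (fun=> 1), (fun=> n); split=> [j|]; first by rewrite ler01.
by apply/funext => phi; rewrite big_ord1 mul1r.
Qed.

Lemma cone_gen_span G : cone_gen G `<=` @lspan R _ (fun n => n \in G).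
Proof. by move=> x [k [c [n [cn ->]]]]; apply/lspanP; exists k, c, n; split=> // j; case: (cn j). Qed.

Lemma is_subgroup_latt s : is_subgroup (latt_of s).
Proof.
split=> [|x y sx sy]; rewrite /latt_of /=.
  suff <- : (fun=> 0) = @emb R N 0 by exact: rspan0.
  by apply/funext => phi; rewrite /emb raddf0.
suff <- : (fun phi => emb x phi + (-1) * emb y phi) = @emb R N (x - y).
  by apply: rspanD => //; apply: rspanZ.
by apply/funext => phi; rewrite /emb raddfB mulN1r.
Qed.

Lemma face_sub s t : is_face t s -> t `<=` s.
Proof. by move=> [u [_ ->]] x []. Qed.

End Cones.

Section KMfans.
Variables (R : realType) (K : KMfan R).
Hypothesis kmK : is_KM K.
Implicit Types (s t : set (VR R (kmN K))) (n : kmN K).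

Lemma km_fg : fingen (kmN K). Proof. by case: kmK. Qed.

Lemma km_subgroup s : Fan K s -> is_subgroup (Lat K s).
Proof. by case: kmK => _ _ H _ /H[]. Qed.

Lemma km_latt s n : Fan K s -> Lat K s n -> rspan s (emb n).
Proof. by case: kmK => _ _ H _ /H[_ H' _ _] /H'. Qed.

Lemma km_mulrn s n : Fan K s -> rspan s (emb n) -> exists2 k, (0 < k)%N & Lat K s (n *+ k).
Proof.
move=> Fs; case: kmK => _ _ /(_ s Fs)[sg _ _ fi] _ sn.
exact: fin_index_mulrn (is_subgroup_latt s) fi sn.
Qed.

Lemma km_face s t n : Fan K s -> is_face t s -> Lat K t n <-> Lat K s n /\ rspan t (emb n).
Proof. by case: kmK => _ _ _ H Fs ts; rewrite (H s t Fs ts). Qed.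

Lemma km_face_lat s t : Fan K s -> is_face t s -> Lat K t `<=` Lat K s.
Proof. by move=> Fs ts n /(km_face n Fs ts)[]. Qed.

Lemma km_face_fan s t : Fan K s -> is_face t s -> Fan K t.
Proof. by case: kmK => _ [_ _ _ H _] _ _; apply: H. Qed.

Lemma km_faceI s t : Fan K s -> Fan K t -> is_face (s `&` t) s /\ is_face (s `&` t) t.
Proof. by case: kmK => _ [_ _ _ _ H] _ _; apply: H. Qed.

Lemma km_cone s : Fan K s -> is_cone s.
Proof. by case: kmK => _ [_ _ H _ _] _ _ /H[]. Qed.

Lemma km_sharp s : Fan K s -> sharp s.
Proof. by case: kmK => _ [_ _ H _ _] _ _ /H[]. Qed.

(** The generators of [s] may lie outside [Lat K s], but finite index puts a positive multiple of
    each inside. *)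
Lemma km_cone_span s : Fan K s -> s `<=` @lspan R _ (Lat K s).
Proof.
move=> Fs; have [G sG] := km_cone Fs.
rewrite {1}sG => x /cone_gen_span; apply: rspan_min => _ [n Gn <-].
have [|k k_gt0 sk] := @km_mulrn s n Fs; last exact: lspan_mulrnW sk.
by apply: rspan_sub; rewrite sG; apply: mem_cone_gen.
Qed.

End KMfans.

(** * Semi-tame morphisms *)

Lemma is_mor_id (R : realType) (K : KMfan R) (f : {additive kmN K -> kmN K}) :
  (forall x, f x = x) -> is_mor f.
Proof.
move=> f_id s Fs; exists s; split=> // [_ [x sx <-]|_ [x sx <-]]; last by rewrite f_id.
by rewrite fR_id.
Qed.

Lemma is_mor_comp (R : realType) (K1 K2 K3 : KMfan R) (f : {additive kmN K1 -> kmN K2})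
    (g : {additive kmN K2 -> kmN K3}) : is_mor f -> is_mor g -> is_mor (g \o f).
Proof.
move=> morf morg s Fs; have [t [Ft st Lt]] := morf s Fs; have [r [Fr tr Lr]] := morg t Ft.
exists r; split=> // _ [x sx <-]; last by apply: Lr; exists (f x) => //; apply: Lt; exists x.
by rewrite -(fR_comp (f := f) (g := g))//; apply: tr; exists (fR f x) => //; apply: st; exists x.
Qed.

Section SemiTame.
Variables (R : realType) (K' K : KMfan R) (f : {additive kmN K' -> kmN K}).
Hypotheses (kmK' : is_KM K') (kmK : is_KM K) (stf : semitame f).
Implicit Types (s t : set (VR R (kmN K'))).

Lemma semitame_inj s x y : Fan K' s -> Lat K' s x -> Lat K' s y -> f x = f y -> x = y.
Proof. by case: stf => _ H _ _ /H[_ _ + _]; apply. Qed.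

Lemma semitame_fan s : Fan K' s -> Fan K (fR f @` s).
Proof. by case: stf => _ H _ _ /H[]. Qed.

Lemma semitame_lat s : Fan K' s -> f @` Lat K' s = Lat K (fR f @` s).
Proof. by case: stf => _ H _ _ /H[]. Qed.

Lemma semitame_fan_inj s t : Fan K' s -> Fan K' t -> fR f @` s = fR f @` t -> s = t.
Proof. by case: stf => _ _ H _; apply: H. Qed.

Lemma semitame_fan_surj (t : set (VR R (kmN K))) : Fan K t -> exists2 s, Fan K' s & fR f @` s = t.
Proof. by case: stf => _ _ _ H /H[s []]; exists s. Qed.

(** A supporting form [u] of the image pulls back to the supporting form [u \o f] of [s]. *)
Lemma semitame_face s r : is_face r (fR f @` s) ->
  exists2 t, is_face t s & fR f @` t = r.
Proof.
move=> [u [u_ge0 ->]]; exists [set x | s x /\ x (u \o f) = 0].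
  by exists (u \o f); split=> // x sx; apply: (u_ge0 (fR f x)); exists x.
apply/seteqP; split=> [_ [x [sx xu] <-]|_ [[x sx <-] xu]]; last by exists x.
by split=> //; exists x.
Qed.

Lemma semitame_faceW s t : Fan K' s -> Fan K' t -> is_face (fR f @` t) (fR f @` s) ->
  is_face t s.
Proof.
move=> Fs Ft /semitame_face[t' t's e].
suff <- : t' = t by [].
by apply: semitame_fan_inj e => //; apply: km_face_fan t's.
Qed.

(* A morphism to K' is determined by its composite with f: both images of a
   cone lie in the cone of K' over the intersection of their images in K. *)
Lemma semitame_faithful (M : KMfan R) (h1 h2 : {additive kmN M -> kmN K'}) :
    is_mor h1 -> is_mor h2 -> (forall x, f (h1 x) = f (h2 x)) ->
  forall (s : set (VR R (kmN M))) n, Fan M s -> Lat M s n -> rspan s (emb n) -> h1 n = h2 n.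
Proof.
move=> mor1 mor2 h12 s n Fs sn spn.
have [t1 [Ft1 st1 Lt1]] := mor1 s Fs; have [t2 [Ft2 st2 Lt2]] := mor2 s Fs.
have [fFt1 fFt2] := (semitame_fan Ft1, semitame_fan Ft2).
have [r1 r2] := km_faceI kmK fFt1 fFt2.
set r := _ `&` _ in r1 r2.
have [t t1t tr] := semitame_face r1.
have [t' t2t' t'r] := semitame_face r2.
have Ft := km_face_fan kmK' Ft1 t1t.
(* The faces of [t1] and [t2] over [r] agree because cones of [K'] are determined by their images;
   [t] is thus a common face. *)
have tt' : t' = t.
  by apply: semitame_fan_inj => //; [exact: km_face_fan t2t'|rewrite tr].
rewrite {}tt' {t'r} in t2t'.
have [x1 x2] : Lat K' t1 (h1 n) /\ Lat K' t2 (h2 n).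
  by split; [apply: Lt1|apply: Lt2]; exists n.
(* The span of [s] maps into the span of both cones' intersection [r], so [f (h1 n)] is in the
   lattice of [r] and lifts to [m] in that of [t]. Injectivity of [f] on the lattices of [t1] and
   [t2] identifies [m] with both [h1 n] and [h2 n]. *)
have [m tm fm] : exists2 m, Lat K' t m & f m = f (h1 n).
  have : Lat K r (f (h1 n)).
    apply/(km_face kmK _ fFt1 r1); split.
      by rewrite -semitame_lat//; exists (h1 n).
    have : (fR (f \o h1) @` rspan s) (emb (f (h1 n))) by exists (emb n).
    rewrite -rspan_fR; apply: rspan_mono => _ [x sx <-]; split.
      exists (fR h1 x); first by apply: st1; exists x.
      exact: fR_comp.
    exists (fR h2 x); first by apply: st2; exists x.
    by apply: fR_comp => y /=; rewrite h12.
  by rewrite -tr -semitame_lat// => -[m]; exists m.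
have e1 : m = h1 n by apply: (semitame_inj Ft1) => //; apply: (km_face_lat kmK' Ft1 t1t).
rewrite -e1; apply: (semitame_inj Ft2) => //; first exact: (km_face_lat kmK' Ft2 t2t').
by rewrite fm h12.
Qed.

End SemiTame.

Lemma semitame_comp (R : realType) (K1 K2 K3 : KMfan R) (f : {additive kmN K1 -> kmN K2})
    (g : {additive kmN K2 -> kmN K3}) (h : {additive kmN K1 -> kmN K3}) :
  (forall x, g (f x) = h x) -> semitame f -> semitame g -> semitame h.
Proof.
move=> gf [morf stf injf surjf] [morg stg injg surjg].
have hE (s : set (VR R (kmN K1))) : fR h @` s = fR g @` (fR f @` s).
  by rewrite image_comp; apply: eq_imagel => x _ /=; rewrite (fR_comp gf).
split.
- move=> s /stf[Fs _ _ Lf]; have [t [Ft st Lt]] := morg _ Fs.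
  exists t; split=> //; first by rewrite hE.
  by apply: subset_trans Lt => _ [n sn <-]; exists (f n) => //; rewrite -Lf; exists n.
- move=> s /stf[/stg[Fs injs injL Lg] injs' injL' Lf]; rewrite hE; split=> //.
  + move=> x y sx sy; rewrite -!(fR_comp gf) => e; apply: injs' => //.
    exact: injs.
  + move=> x y sx sy; rewrite -!gf => e; apply: injL' => //.
    by apply: injL => //; rewrite -Lf; [exists x|exists y].
  + by rewrite -Lg -Lf image_comp; apply: eq_imagel => x _ /=; rewrite gf.
- move=> s t Fs Ft; rewrite !hE => /injg e; apply: injf => //; apply: e.
    by case: (stf _ Fs).
  by case: (stf _ Ft).
- move=> t /surjg[s [/surjf[r [Fr <-]] <-]]; exists r; split=> //.
Qed.

(** * Unfoldings *)

(** Joint generation phrased as an induction principle. Unlike the universal property among all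
    abelian groups, it visibly passes to quotients of [L]. *)
Definition generated (R : realType) (K : KMfan R) (L : zmodType)
    (i : set (VR R (kmN K)) -> kmN K -> L) :=
  forall P : set L, is_subgroup P -> (forall s n, Fan K s -> Lat K s n -> P (i s n)) ->
  forall y, P y.

Section SubgroupType.
Variables (L : zmodType) (P : set L).

(** The universal property ranges over [zmodType], so a subgroup given as a set must first be made
    into such a type. *)
Definition subgroup_pred of is_subgroup P : {pred L} := fun y => `[< P y >].

Variable sgP : is_subgroup P.

Fact subgroup_pred_closed : zmod_closed (subgroup_pred sgP).
Proof.
split=> [|x y]; first by apply/asboolP; apply: subgroup0.
by move=> /asboolP Px /asboolP Py; apply/asboolP; apply: subgroupB.
Qed.

HB.instance Definition _ := GRing.isZmodClosed.Build L (subgroup_pred sgP) subgroup_pred_closed.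

Definition subgroup_type := {y | y \in subgroup_pred sgP}.

HB.instance Definition _ := SubChoice.on subgroup_type.
HB.instance Definition _ := [SubChoice_isSubZmodule of subgroup_type by <:].

End SubgroupType.

(* Compare the identity of L with L -> P -> L, where L -> P comes from the
   universal property of the colimit. *)
Lemma colim_generated (R : realType) (K : KMfan R) (L : zmodType)
    (i : set (VR R (kmN K)) -> kmN K -> L) :
  is_KM K -> is_colim i -> generated i.
Proof.
move=> kmK [[iD iface] univ] P sgP Pi y.
pose S : zmodType := subgroup_type sgP.
have P0 : 0 \in subgroup_pred sgP by apply/asboolP; apply: subgroup0.
(* Off [Lat K s] the value [i s n] is junk and may leave [P]; [insubd] then returns 0. *)
pose g s n : S := insubd (Sub 0 P0 : S) (i s n).
have gE s n : Fan K s -> Lat K s n -> val (g s n) = i s n.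
  by move=> Fs sn; rewrite insubdK//; apply/asboolP/Pi.
have cg : compat_fam g.
  split=> [s Fs x x' sx sx'|s t Fs ts n tn]; apply: val_inj.
    rewrite raddfD/= !gE ?iD//.
    by apply: subgroupD => //; apply: km_subgroup.
  have Ft := km_face_fan kmK Fs ts.
  by rewrite !gE ?(iface s t)//; apply: (km_face_lat kmK Fs ts).
have [[h hE] _] := univ S g cg.
have [_ uniq] := univ L i (conj iD iface).
have -> : y = (idfun : {additive L -> L}) y by [].
rewrite (uniq idfun (val \o h)) => [|//|s n Fs sn]; last by rewrite /= hE ?gE.
exact/asboolP/(valP (h y)).
Qed.

Lemma generated_eq (R : realType) (K : KMfan R) (L A : zmodType)
    (i : set (VR R (kmN K)) -> kmN K -> L) (h1 h2 : {additive L -> A}) :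
    generated i -> (forall s n, Fan K s -> Lat K s n -> h1 (i s n) = h2 (i s n)) ->
  forall y, h1 y = h2 y.
Proof.
move=> gi h12; apply: (gi [set y | h1 y = h2 y]) => [|s n]; last exact: h12.
by split=> [|x y /= ex ey]; rewrite /= ?raddf0// !raddfB ex ey.
Qed.

(** There are finitely many cones, and each [Lat K s] is finitely generated as a subgroup of
    [kmN K]; the images of all these generators suffice. *)
Lemma generated_fingen (R : realType) (K : KMfan R) (L : zmodType)
    (i : set (VR R (kmN K)) -> kmN K -> L) :
  is_KM K -> compat_fam i -> generated i -> fingen L.
Proof.
move=> kmK [iD _] gi; have [_ [/finite_seqP[Fs FsE] _ _ _ _] _ _] := kmK.
have /choice[l lP] s : exists l : seq (kmN K), Fan K s ->
    (forall x, x \in l -> Lat K s x) /\ Lat K s `<=` zspan l.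
  have [Fs'|nF] := pselect (Fan K s); last by exists [::].
  have /fingenP[l lP] := km_fg kmK.
  by have [l' ?] := @subgroup_fingen _ l (Lat K s) (km_subgroup kmK Fs') (fun x _ => lP x); exists l'.
apply/fingenP; exists (flatten [seq [seq i s x | x <- l s] | s <- Fs]); apply: gi.
  exact: is_subgroup_zspan.
move=> s n Fs' sn; have [ls sl] := lP s Fs'.
have sgs := km_subgroup kmK Fs'.
set ll := flatten _.
have sgP := is_subgroup_preimage sgs (iD s Fs') (is_subgroup_zspan ll).
apply: (zspan_min sgP _ (sl n sn)).2 => x lx; split; first exact: ls.
apply: mem_zspan; apply/flatten_mapP; exists s; last exact: map_f.
by move: Fs'; rewrite FsE.
Qed.

(** * Cones, faces and lattices of the unfolding *)

Section Unfolding.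
Variables (R : realType) (K : KMfan R) (L : zmodType).
Variables (i : set (VR R (kmN K)) -> kmN K -> L) (b : {additive L -> kmN K}).
Hypotheses (kmK : is_KM K) (ci : compat_fam i) (ib : is_beta i b).
Implicit Types (s t : set (VR R (kmN K))) (y z : VR R L).

Let T s : set L := i s @` Lat K s.

Lemma is_subgroup_unfold s : Fan K s -> is_subgroup (T s).
Proof.
move=> Fs; have sgs := km_subgroup kmK Fs; have iD := ci.1 s Fs.
split; first by exists 0; [exact: subgroup0|exact: additive_on0 iD].
move=> _ _ [n sn <-] [m sm <-]; exists (n - m); first exact: subgroupB.
exact: (additive_onB sgs iD).
Qed.

Lemma beta_inj s x x' : Fan K s -> T s x -> T s x' -> b x = b x' -> x = x'.
Proof. by move=> Fs [n sn <-] [m sm <-]; rewrite !ib// => ->. Qed.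

Lemma beta_image s : Fan K s -> b @` T s = Lat K s.
Proof.
move=> Fs; apply/seteqP; split=> [_ [_ [n sn <-] <-]|n sn]; first by rewrite ib.
by exists (i s n); [exists n|rewrite ib].
Qed.

(** [b] splits [i s], hence is injective on [T s]. Equalities inside one such span can therefore be
    tested after applying [fR b]. *)
Lemma unfold_span_inj s y z : Fan K s ->
  @lspan R _ (T s) y -> @lspan R _ (T s) z -> fR b y = fR b z -> y = z.
Proof.
move=> Fs; apply: fR_inj; [exact: km_fg|exact: is_subgroup_unfold|].
by move=> x x'; apply: beta_inj.
Qed.

Lemma unfold_lift s x : Fan K s -> @lspan R _ (Lat K s) x ->
  exists2 y, @lspan R _ (T s) y & fR b y = x.
Proof. by move=> Fs; rewrite -beta_image// lspan_fR. Qed.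

(** [fR b] undoes [i s] on real combinations, so the parametrized cone is the part of the span of
    [T s] lying over [s]. *)
Lemma imconeP s y : Fan K s -> imcone i s y <-> @lspan R _ (T s) y /\ s (fR b y).
Proof.
have bE k (c : 'I_k -> R) (n : 'I_k -> kmN K) : Fan K s -> (forall j, Lat K s (n j)) ->
    fR b (fun psi => \sum_j c j * psi (i s (n j))) = fun phi => \sum_j c j * phi (n j).
  by move=> Fs sn; apply/funext => phi; apply: eq_bigr => j _; rewrite /= ib.
move=> Fs; split=> [[k [c [n [sn sx ->]]]]|[/lspanP[k [c [m [Tm ->]]]]]].
  rewrite bE//; split=> //; apply/lspanP; exists k, c, (fun j => i s (n j)).
  by split=> // j; exists (n j).
have /choice[n nP] j : exists n, Lat K s n /\ i s n = m j by have [n] := Tm j; exists n.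
have -> : m = fun j => i s (n j) by apply/funext => j; case: (nP j).
have sn j : Lat K s (n j) by case: (nP j).
by rewrite bE// => sx; exists k, c, n.
Qed.

Lemma imcone_image s : Fan K s -> fR b @` imcone i s = s.
Proof.
move=> Fs; apply/seteqP; split=> [_ [y /(imconeP _ Fs)[_ ?] <-]//|x sx].
have [y Ty yx] := unfold_lift Fs (km_cone_span kmK Fs sx).
by exists y => //; apply/(imconeP _ Fs); rewrite yx.
Qed.

Lemma imcone_inj s t : Fan K s -> Fan K t -> imcone i s = imcone i t -> s = t.
Proof. by move=> Fs Ft st; rewrite -(imcone_image Fs) st imcone_image. Qed.

Lemma unfold_face s t : Fan K s -> is_face t s -> T t `<=` T s.
Proof.
move=> Fs ts _ [n tn <-]; exists n; first exact: (km_face_lat kmK Fs ts).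
by rewrite (ci.2 s t).
Qed.

(** A point over [t] lifts to the span of [T t]; inside the larger span of [T s] this lift must be
    [y] itself. *)
Lemma imcone_face s t y : Fan K s -> is_face t s ->
  imcone i t y <-> imcone i s y /\ t (fR b y).
Proof.
move=> Fs ts; have Ft := km_face_fan kmK Fs ts; have Tts := unfold_face Fs ts.
split=> [/(imconeP _ Ft)[Ty ty]|[/(imconeP _ Fs)[Ty _] ty]].
  split=> //; apply/(imconeP _ Fs); split; first exact: lspan_mono Ty.
  exact: face_sub ts _ ty.
have [z Tz zy] := unfold_lift Ft (km_cone_span kmK Ft ty).
suff <- : z = y by apply/(imconeP _ Ft); rewrite zy.
by apply: (unfold_span_inj Fs) => //; apply: lspan_mono Tz.
Qed.

Lemma is_face_imcone s t : Fan K s -> is_face t s -> is_face (imcone i t) (imcone i s).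
Proof.
move=> Fs ts; have [u [u_ge0 tE]] := ts; exists (u \o b); split.
  by move=> y /(imconeP _ Fs)[_ sy]; apply: (u_ge0 (fR b y)).
apply/seteqP; split=> y; rewrite (imcone_face _ Fs ts) => -[ys].
  by rewrite tE => -[].
move=> yu; split=> //; rewrite tE; split=> //.
by case/(imconeP _ Fs): ys.
Qed.

(** A supporting form [w] on [L] need not factor through [b], but on the span of [T s] it agrees
    with some [phi \o b], and [phi] cuts out the required face of [s]. *)
Lemma imcone_faceP s r : Fan K s -> is_face r (imcone i s) ->
  exists2 t, is_face t s & r = imcone i t.
Proof.
move=> Fs [w [w_ge0 rE]].
have [phi phiE] := dual_extend w (km_fg kmK) (is_subgroup_unfold Fs)
  (fun x x' => @beta_inj s x x' Fs).
have ts : is_face [set x | s x /\ x phi = 0] s.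
  exists phi; split=> // x; rewrite -{1}(imcone_image Fs) => -[y sy <-].
  by rewrite -phiE; [exact: w_ge0|case/(imconeP _ Fs): sy].
exists [set x | s x /\ x phi = 0] => //.
apply/seteqP; split=> y; rewrite rE (imcone_face _ Fs ts) /=.
  by move=> [sy yw]; have /(imconeP _ Fs)[Ty ?] := sy; rewrite -phiE.
by move=> [sy [_ yphi]]; have /(imconeP _ Fs)[Ty ?] := sy; rewrite phiE.
Qed.

Lemma imconeI s t : Fan K s -> Fan K t ->
  imcone i s `&` imcone i t = imcone i (s `&` t).
Proof.
move=> Fs Ft; have [rs rt] := km_faceI kmK Fs Ft.
apply/seteqP; split=> y.
  move=> [ys yt]; apply/(imcone_face _ Fs rs); split=> //.
  by split; [case/(imconeP _ Fs): ys|case/(imconeP _ Ft): yt].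
by move=> yr; split; [case/(imcone_face _ Fs rs): yr|case/(imcone_face _ Ft rt): yr].
Qed.

Lemma unfold_fan s : Fan K s -> Fan (unfold i) (imcone i s).
Proof. by exists s. Qed.

Lemma unfold_lat s : Fan K s -> Lat (unfold i) (imcone i s) = T s.
Proof.
move=> Fs; apply/seteqP; split=> [_ [t [Ft /(imcone_inj Fs Ft) <- [n [sn ->]]]]|_ [n sn <-]].
  by exists n.
by exists s; split=> //; exists n.
Qed.

Lemma imcone_span s : Fan K s -> rspan (imcone i s) = @lspan R _ (T s).
Proof.
move=> Fs; apply/seteqP; split; first by apply: rspan_min => y /(imconeP _ Fs)[].
apply: rspan_min => _ [_ [n sn <-] <-].
have : rspan (fR b @` imcone i s) (emb n) by rewrite imcone_image//; apply: km_latt.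
rewrite rspan_fR => -[y ys ye]; suff <- : y = emb (i s n) by [].
apply: (unfold_span_inj Fs).
- by apply: rspan_min ys => z /(imconeP _ Fs)[].
- by apply: lspan_emb; exists n.
- by rewrite ye; apply/funext => phi; rewrite /fR /emb /= ib.
Qed.

(** A generator [g] of [s] is replaced by [i s (g *+ d g)], with [d g] positive and bringing [g]
    into [Lat K s]; coefficients are rescaled by [d g]. *)
Lemma is_cone_imcone s : Fan K s -> is_cone (imcone i s).
Proof.
move=> Fs; have [G sG] := km_cone kmK Fs.
have /choice[d dP] g : exists d : nat, g \in G -> (0 < d)%N /\ Lat K s (g *+ d).
  have [gG|_] := boolP (g \in G); last by exists 0%N.
  have [|d ? ?] := @km_mulrn _ _ kmK s g Fs; last by exists d.
  by apply: rspan_sub; rewrite sG; apply: mem_cone_gen.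
pose m g := i s (g *+ d g).
have bm g : g \in G -> b (m g) = g *+ d g by move=> /dP[_ sg]; rewrite ib.
exists [seq m g | g <- G]; apply/seteqP; split=> y.
  move=> /(imconeP _ Fs)[Ty sy].
  have : cone_gen G (fR b y) by rewrite -sG.
  move=> [k [c [n [cn yE]]]].
  have dn j : (0 < d (n j))%N by case: (cn j) => _ /dP[].
  have -> : y = fun psi : dualR R L => \sum_j (c j / (d (n j))%:R) * psi (m (n j)).
    apply: (unfold_span_inj Fs) => //.
      apply/lspanP; exists k, (fun j => c j / (d (n j))%:R), (fun j => m (n j)).
      by split=> // j; exists (n j *+ d (n j)) => //; case: (cn j) => _ /dP[].
    rewrite yE; apply/funext => phi; apply: eq_bigr => j _ /=.
    rewrite bm; last by case: (cn j).
    by rewrite raddfMn -[phi _ *+ _]mulr_natl mulrA divfK// pnatr_eq0 -lt0n.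
  exists k, (fun j => c j / (d (n j))%:R), (fun j => m (n j)); split=> // j.
  by case: (cn j) => c0 nG; split; [rewrite divr_ge0|exact: map_f].
move=> [k [c [n [cn ->]]]].
have /choice[g gP] j : exists g, g \in G /\ n j = m g.
  by case: (cn j) => _ /mapP[g gG nE]; exists g.
apply/(imconeP _ Fs); split.
  apply/lspanP; exists k, c, n; split=> // j; have [/dP[_ sg] ->] := gP j.
  by exists (g j *+ d (g j)).
rewrite sG; exists k, (fun j => c j * (d (g j))%:R), g; split=> [j|].
  by have [gG _] := gP j; have [c0 _] := cn j; rewrite mulr_ge0.
apply/funext => phi; apply: eq_bigr => j _ /=; have [gG ->] := gP j.
by rewrite bm// raddfMn -[phi _ *+ _]mulr_natl mulrA.
Qed.

Hypothesis gi : generated i.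

Lemma unfold_fingen : fingen L. Proof. exact: generated_fingen kmK ci gi. Qed.

(* y - i_s(b y) is torsion once b y lies in F_s, since b_R is injective on
   the span of i(s). *)
Lemma unfold_latt s x : Fan K s -> rspan (imcone i s) (emb x) -> Lat K s (b x) ->
  exists2 k, (0 < k)%N & (x - i s (b x)) *+ k = 0.
Proof.
move=> Fs; rewrite imcone_span// => Tx sbx; apply: (@emb_eq0 R); first exact: unfold_fingen.
have xE : @emb R _ x = emb (i s (b x)).
  apply: (unfold_span_inj Fs) => //; first by apply: lspan_emb; exists (b x).
  by apply/funext => phi; rewrite /fR /emb /= ib.
by apply/funext => psi; rewrite /emb raddfB; apply/eqP; rewrite subr_eq0; apply/eqP/(congr1 (@^~ psi) xE).
Qed.

Lemma rspan_beta s x : Fan K s -> rspan (imcone i s) (emb x) -> rspan s (emb (b x)).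
Proof. by move=> Fs sx; rewrite -(imcone_image Fs) rspan_fR; exists (emb x). Qed.

Lemma unfold_KM : is_KM (unfold i).
Proof.
split; first exact: unfold_fingen.
- split.
  + have -> : Fan (unfold i) = imcone i @` Fan K.
      by apply/seteqP; split=> [_ [s [Fs ->]]|_ [s Fs <-]]; exists s.
    by apply: finite_image; case: kmK => _ [].
  + by case: kmK => _ [_ [s Fs] _ _ _] _ _; exists (imcone i s); exists s.
  + move=> _ [s [Fs ->]]; split; first exact: is_cone_imcone.
    move=> y /(imconeP _ Fs)[Ty sy] /(imconeP _ Fs)[_ sNy].
    apply: (unfold_span_inj Fs) => //; first exact: rspan0.
    exact: (km_sharp kmK Fs sy sNy).
  + move=> _ r [s [Fs ->]] /(imcone_faceP Fs)[t ts ->].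
    exact/unfold_fan/(km_face_fan kmK Fs ts).
  + move=> _ _ [s [Fs ->]] [t [Ft ->]]; rewrite imconeI//.
    by have [rs rt] := km_faceI kmK Fs Ft; split; apply: is_face_imcone.
- move=> _ [s [Fs ->]]; rewrite unfold_lat//; have sgT := is_subgroup_unfold Fs.
  split=> //.
  + by move=> x Tx; rewrite /latt_of /= imcone_span//; apply: lspan_emb.
  + move=> _ k [n sn <-] k_gt0 /(congr1 b); rewrite raddfMn ib// raddf0 => nk.
    have [_ _ /(_ s Fs)[_ _ tf _] _] := kmK.
    by rewrite (tf n k)//; apply: additive_on0 (ci.1 s Fs); apply: km_subgroup.
  (* It suffices that each generator [x] of the lattice has a positive multiple in [T s]:
     multiplying by [k] brings [b x] into [Lat K s], then [p] kills the torsion discrepancy. *)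
  + have /fingenP[l lP] := unfold_fingen.
    have [l' [Al' l'P]] := subgroup_fingen (is_subgroup_latt (imcone i s)) (fun x _ => lP x).
    apply: (zspan_fin_index sgT l'P) => x /Al' sx.
    have [k k_gt0 sk] := km_mulrn kmK Fs (rspan_beta Fs sx).
    rewrite -raddfMn in sk.
    have [|p p_gt0] := unfold_latt Fs _ sk.
      exact: (subgroupMn (is_subgroup_latt (imcone i s))).
    rewrite mulrnBl => /eqP; rewrite subr_eq0 -mulrnA => /eqP e.
    exists (k * p)%N; first by rewrite muln_gt0 k_gt0.
    by rewrite e; apply: subgroupMn => //; exists (b (x *+ k)).
- move=> _ r [s [Fs ->]] /(imcone_faceP Fs)[t ts ->].
  have Ft := km_face_fan kmK Fs ts; rewrite !unfold_lat//.
  apply/seteqP; split=> x.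
    move=> Tx; split; first exact: unfold_face Tx.
    by rewrite /latt_of /= imcone_span//; apply: lspan_emb.
  (* Applying [b] puts [n] in the span of [t], and the face condition in [K] then gives [n] in
     [Lat K t]. *)
  move=> [[n sn <-] nt]; have := rspan_beta Ft nt; rewrite ib// => tn.
  have nt' : Lat K t n by apply/(km_face kmK _ Fs ts).
  by exists n => //; apply: ci.2.
Qed.

Lemma unfold_semitame : @semitame R (unfold i) K b.
Proof.
split.
- move=> _ [s [Fs ->]]; exists s; split=> //; first by rewrite imcone_image.
  by rewrite unfold_lat// beta_image.
- move=> _ [s [Fs ->]]; rewrite imcone_image// unfold_lat// beta_image//; split=> //.
    by move=> y z /(imconeP _ Fs)[Ty _] /(imconeP _ Fs)[Tz _]; apply: (unfold_span_inj Fs).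
  by move=> x x'; apply: beta_inj.
- by move=> _ _ [s [Fs ->]] [t [Ft ->]]; rewrite !imcone_image// => ->.
- by move=> s Fs; exists (imcone i s); split; [exists s|exact: imcone_image].
Qed.

(** Atoroidality makes the image of [b] span everything over the reals, so each generator of [kmN K]
    has a positive multiple in it, and the cokernel is finite. *)
Lemma unfold_tame : atoroidal K -> tfree [set x | b x = 0] -> @tame R (unfold i) K b.
Proof.
move=> atK tfb; split=> //; first exact: unfold_semitame.
have sgb := is_subgroup_image b (@is_subgroupT L).
have /fingenP[l lP] := km_fg kmK.
have [|k [r rP]] := zspan_fin_index (B := setT) sgb (fun x _ => lP x).
  move=> n _; apply: (@lspan_mulrn R _ _ n (km_fg kmK) sgb).
  apply: rspan_min (atK n) => x [s Fs sx].
  apply: lspan_mono (km_cone_span kmK Fs sx) => m sm.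
  by exists (i s m) => //; apply: ib.
exists k, r => n; have [j [x _ xe]] := rP n I.
by exists j, x; rewrite xe addrC subrK.
Qed.

(** For [x] in the span of [i(s)], classicality puts [b x] in [Lat K s]; the torsion element
    [x - i s (b x)] then vanishes. *)
Lemma unfold_classical : tfree [set: L] -> classical_fan K -> classical_fan (unfold i).
Proof.
move=> tfL [_ clK]; split; first by split; [exact: unfold_KM|].
move=> _ [s [Fs ->]]; have [_ _ /(_ _ (unfold_fan Fs))[_ sub _ _] _] := unfold_KM.
apply/seteqP; split=> // x sx; rewrite unfold_lat//.
have sbx : Lat K s (b x) by rewrite clK//; apply: rspan_beta.
have [k k_gt0 xk] := unfold_latt Fs sx sbx.
exists (b x) => //; apply/eqP; rewrite eq_sym -subr_eq0; apply/eqP.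
exact: (tfL _ k).
Qed.

(** Control on lattices forces control on cones: [fR h y] and the point of [s'] over [fR b y] both
    lie in the span of [Lat K' s'], where [fR f] is injective. *)
Lemma unfold_mor (K' : KMfan R) (f : {additive kmN K' -> kmN K}) (h : {additive L -> kmN K'}) :
    is_KM K' -> semitame f -> (forall x, f (h x) = b x) ->
    (forall s n, Fan K s -> Lat K s n ->
       exists s' : set (VR R (kmN K')), [/\ Fan K' s', fR f @` s' = s & Lat K' s' (h (i s n))]) ->
  @is_mor R (unfold i) K' h.
Proof.
move=> kmK' stf fh hi _ [s [Fs ->]].
have [s' Fs' fs'] := semitame_fan_surj stf Fs.
have hs n : Lat K s n -> Lat K' s' (h (i s n)).
  move=> sn; have [t' [Ft' ft' +]] := hi s n Fs sn.
  by rewrite (semitame_fan_inj stf Fs' Ft')// ft'.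
exists s'; split=> //; last by rewrite unfold_lat// => _ [_ [n sn <-] <-]; apply: hs.
move=> _ [y /(imconeP _ Fs)[Ty sy] <-].
have [x s'x xy] : exists2 x, s' x & fR f x = fR b y by move: sy; rewrite -{1}fs' => -[x]; exists x.
suff <- : x = fR h y by [].
apply: (fR_inj (f := f) (km_fg kmK) (km_subgroup kmK' Fs')).
- by move=> n n'; apply: (semitame_inj stf Fs').
- exact: (km_cone_span kmK').
- have : (fR h @` @lspan R _ (T s)) (fR h y) by exists y.
  by rewrite -lspan_fR; apply: lspan_mono => _ [_ [n sn <-] <-]; apply: hs.
- by rewrite xy (fR_comp fh).
Qed.

Lemma unfold_mor_unique (K1 K2 : KMfan R) (f : {additive kmN K1 -> kmN K2})
    (g1 g2 : {additive L -> kmN K1}) : is_KM K1 -> is_KM K2 -> semitame f ->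
    @is_mor R (unfold i) K1 g1 -> @is_mor R (unfold i) K1 g2 ->
  (forall x, f (g1 x) = f (g2 x)) -> forall x, g1 x = g2 x.
Proof.
move=> km1 km2 stf m1 m2 fg; apply: (generated_eq gi) => s n Fs sn.
have Tn : T s (i s n) by exists n.
apply: (semitame_faithful km1 km2 stf m1 m2 fg (s := imcone i s)).
- exact: unfold_fan.
- by rewrite unfold_lat.
- by rewrite imcone_span//; apply: lspan_emb.
Qed.

End Unfolding.

(** * The universal property *)

Section Colimit.
Variables (R : realType) (K : KMfan R) (L : zmodType).
Variables (i : set (VR R (kmN K)) -> kmN K -> L) (b : {additive L -> kmN K}).
Hypotheses (kmK : is_KM K) (colim_i : is_colim i) (ib : is_beta i b).

(** The maps inverse to [f] on lattices form a cocone. The second conclusion is kept apart from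
    [is_mor] so that it can also be used after factoring [h] through a torsion quotient. *)
Lemma colim_lift (K' : KMfan R) (f : {additive kmN K' -> kmN K}) :
    is_KM K' -> semitame f ->
  exists h : {additive L -> kmN K'}, (forall x, f (h x) = b x) /\
    forall s n, Fan K s -> Lat K s n ->
      exists s' : set (VR R (kmN K')), [/\ Fan K' s', fR f @` s' = s & Lat K' s' (h (i s n))].
Proof.
move=> kmK' stf.
(* [g (s, n)] is the preimage of [n] in the lattice of the cone over [s], and 0 by default when
   there is no such cone or [n] is not in [Lat K s]. *)
have /choice[g gP] (p : set (VR R (kmN K)) * kmN K) : exists m, forall s',
    Fan K' s' -> fR f @` s' = p.1 -> Lat K p.1 p.2 -> Lat K' s' m /\ f m = p.2.
  case: p => s n /=; have [[s' [Fs' fs' sn]]|nex] :=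
    pselect (exists s', [/\ Fan K' s', fR f @` s' = s & Lat K s n]); last first.
    by exists 0 => s' Fs' fs' sn; case: nex; exists s'.
  have : (f @` Lat K' s') n by rewrite semitame_lat// fs'.
  move=> [m sm fm]; exists m => t' Ft' ft' _.
  by rewrite (semitame_fan_inj stf Ft' Fs')// ft'.
have gE s s' n : Fan K' s' -> fR f @` s' = s -> Lat K s n -> Lat K' s' (g (s, n)) /\ f (g (s, n)) = n.
  exact: gP (s, n) s'.
have [|[h hE] _] := colim_i.2 (kmN K') (fun s n => g (s, n)).
  split=> [s Fs x y sx sy|s t Fs ts n tn].
    have [s' Fs' fs'] := semitame_fan_surj stf Fs.
    have [gx fx] := gE s s' x Fs' fs' sx; have [gy fy] := gE s s' y Fs' fs' sy.
    have [|gxy fxy] := gE s s' (x + y) Fs' fs'.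
      by apply: subgroupD => //; apply: km_subgroup.
    apply: (semitame_inj stf Fs') => //; last by rewrite raddfD fxy fx fy.
    by apply: subgroupD => //; apply: km_subgroup.
  have [s' Fs' fs'] := semitame_fan_surj stf Fs.
  have [t' Ft' ft'] := semitame_fan_surj stf (km_face_fan kmK Fs ts).
  (* Once the cone over [t] is a face of the cone over [s], both preimages of [n] lie in
     [Lat K' s'], where [f] is injective. *)
  have t's' : is_face t' s'.
    by apply: (semitame_faceW kmK' stf) => //; rewrite fs' ft'.
  have [gt ft] := gE t t' n Ft' ft' tn.
  have [gs fs] := gE s s' n Fs' fs' (km_face_lat kmK Fs ts tn).
  apply: (semitame_inj stf Fs') => //; last by rewrite ft fs.
  exact: (km_face_lat kmK' Fs' t's').
have hi s n : Fan K s -> Lat K s n ->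
    exists s' : set (VR R (kmN K')), [/\ Fan K' s', fR f @` s' = s & Lat K' s' (h (i s n))].
  move=> Fs sn; have [s' Fs' fs'] := semitame_fan_surj stf Fs.
  by exists s'; split=> //; rewrite hE//; case: (gE s s' n).
exists h; split=> //.
apply: (@generated_eq _ _ _ _ i (f \o h) b (colim_generated kmK colim_i)) => s n Fs sn.
have [s' Fs' fs'] := semitame_fan_surj stf Fs.
by rewrite /= hE// ib//; case: (gE s s' n).
Qed.

Lemma colim_initial (K' : KMfan R) (f : {additive kmN K' -> kmN K}) :
    is_KM K' -> semitame f ->
  exists h : {additive L -> kmN K'}, @is_mor R (unfold i) K' h /\ forall x, f (h x) = b x.
Proof.
move=> kmK' stf; have [h [fh hi]] := colim_lift kmK' stf.
by exists h; split=> //; apply: (unfold_mor kmK ib kmK' stf fh hi).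
Qed.

End Colimit.

(** * Functoriality of the unfolding *)

Section Functor.
Variables (R : realType) (K1 K2 : KMfan R) (L1 L2 : zmodType).
Variables (i1 : set (VR R (kmN K1)) -> kmN K1 -> L1) (i2 : set (VR R (kmN K2)) -> kmN K2 -> L2).
Variables (b1 : {additive L1 -> kmN K1}) (b2 : {additive L2 -> kmN K2}).
Variable f : {additive kmN K1 -> kmN K2}.
Hypotheses (km1 : is_KM K1) (km2 : is_KM K2) (c1 : is_colim i1) (c2 : is_colim i2).
Hypotheses (ib1 : is_beta i1 b1) (ib2 : is_beta i2 b2) (morf : is_mor f).

(* Two cones receiving s share a face that already receives s. *)
Lemma colim_eq_of_cones s (t t' : set (VR R (kmN K2))) n :
    Fan K1 s -> Lat K1 s n -> Fan K2 t -> Fan K2 t' ->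
    fR f @` s `<=` t -> fR f @` s `<=` t' -> Lat K2 t (f n) -> Lat K2 t' (f n) ->
  i2 t (f n) = i2 t' (f n).
Proof.
move=> Fs sn Ft Ft' st st' tn tn'; have [rt rt'] := km_faceI km2 Ft Ft'.
have rn : Lat K2 (t `&` t') (f n).
  apply/(km_face km2 _ Ft rt); split=> //.
  have : (fR f @` rspan s) (emb (f n)) by exists (emb n) => //; exact: (km_latt km1 Fs sn).
  by rewrite -rspan_fR; apply: rspan_mono => x sx; split; [apply: st|apply: st'].
by have [[_ iface] _] := c2; rewrite -(iface _ _ Ft rt)// (iface _ _ Ft' rt').
Qed.

Lemma induces_ex : exists u : {additive L1 -> L2}, induces i1 i2 f u.
Proof.
(* [T s] is any cone of [K2] receiving [s] (junk off the fan); [colim_eq_of_cones] makes the choice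
   irrelevant. *)
have /choice[T TP] s : exists t, Fan K1 s ->
    [/\ Fan K2 t, fR f @` s `<=` t & f @` Lat K1 s `<=` Lat K2 t].
  by have [/morf[t ?]|nF] := pselect (Fan K1 s); [exists t|exists set0].
have [|[u uE] _] := c1.2 L2 (fun s n => i2 (T s) (f n)).
  split=> [s /TP[Ft st Lt] x y sx sy|s r Fs rs n rn].
    by rewrite raddfD c2.1.1//; apply: Lt; [exists x|exists y].
  have Fr := km_face_fan km1 Fs rs; have sn := km_face_lat km1 Fs rs rn.
  have [Ft st Lt] := TP s Fs; have [Ft' st' Lt'] := TP r Fr.
  apply: (colim_eq_of_cones Fr rn) => //.
  - by move=> _ [x /(face_sub rs) sx <-]; apply: st; exists x.
  - by apply: Lt'; exists n.
  - by apply: Lt; exists n.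
exists u => s t Fs Ft st Lt n sn; rewrite uE//.
have [Ft' st' Lt'] := TP s Fs.
by apply: (colim_eq_of_cones Fs sn) => //; [apply: Lt'|apply: Lt]; exists n.
Qed.

Lemma induces_unique (u u' : {additive L1 -> L2}) :
  induces i1 i2 f u -> induces i1 i2 f u' -> forall x, u x = u' x.
Proof.
move=> ui u'i; apply: (generated_eq (colim_generated km1 c1)) => s n Fs sn.
have [t [Ft st Lt]] := morf Fs.
by rewrite (ui s t)// (u'i s t).
Qed.

Variable u : {additive L1 -> L2}.
Hypothesis ui : induces i1 i2 f u.

Lemma induces_beta x : b2 (u x) = f (b1 x).
Proof.
apply: (@generated_eq _ _ _ _ i1 (b2 \o u) (f \o b1) (colim_generated km1 c1)) => s n Fs sn.
have [t [Ft st Lt]] := morf Fs.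
by rewrite /= (ui Fs Ft)// ib1// ib2//; apply: Lt; exists n.
Qed.

Lemma induces_mor : @is_mor R (unfold i1) (unfold i2) u.
Proof.
move=> _ [s [Fs ->]]; have [t [Ft st Lt]] := morf Fs.
have uT : u @` (i1 s @` Lat K1 s) `<=` i2 t @` Lat K2 t.
  by move=> _ [_ [n sn <-] <-]; rewrite (ui Fs Ft)//; exists (f n) => //; apply: Lt; exists n.
exists (imcone i2 t); split; first exact: unfold_fan.
- move=> _ [y /(imconeP ib1 _ Fs)[Ty sy] <-].
  apply/(imconeP ib2 _ Ft); split.
    by apply: lspan_mono uT _ _; rewrite lspan_fR; exists y.
  rewrite (fR_comp (h := f \o b1)); last exact: induces_beta.
  rewrite -(fR_comp (f := b1) (g := f))//.
  by apply: st; exists (fR b1 y).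
- by rewrite (unfold_lat km1 ib1)// (unfold_lat km2 ib2).
Qed.

(** [f \o b1] is semi-tame, so initiality of [b2] yields a candidate inverse [v]. Both composites
    are identities by uniqueness of morphisms over [K2]. *)
Lemma induces_iso : semitame f -> @is_iso R (unfold i1) (unfold i2) u.
Proof.
move=> stf.
have [g1 g2] := (colim_generated km1 c1, colim_generated km2 c2).
have U1 := unfold_KM km1 c1.1 ib1 g1; have U2 := unfold_KM km2 c2.1 ib2 g2.
have st1 := unfold_semitame km1 c1.1 ib1; have st2 := unfold_semitame km2 c2.1 ib2.
have stfb : @semitame R (unfold i1) K2 (f \o b1) by apply: semitame_comp st1 stf.
have [v [morv fbv]] := colim_initial km2 c2 ib2 U1 stfb.
split; first exact: induces_mor.
exists v; split=> //.
- pose vu : {additive L1 -> kmN (unfold i1)} := v \o u.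
  pose id1 : {additive L1 -> kmN (unfold i1)} := idfun.
  have mor_vu : @is_mor R (unfold i1) (unfold i1) vu.
    exact: (@is_mor_comp R (unfold i1) (unfold i2) (unfold i1) u v induces_mor morv).
  have mor_id : @is_mor R (unfold i1) (unfold i1) id1 by exact: (@is_mor_id R (unfold i1)).
  apply: (unfold_mor_unique km1 c1.1 ib1 g1 U1 km2 stfb mor_vu mor_id) => x.
  by rewrite [LHS](fbv (u x)) induces_beta.
- pose uv : {additive L2 -> kmN (unfold i2)} := u \o v.
  pose id2 : {additive L2 -> kmN (unfold i2)} := idfun.
  have mor_uv : @is_mor R (unfold i2) (unfold i2) uv.
    exact: (@is_mor_comp R (unfold i2) (unfold i1) (unfold i2) v u morv induces_mor).
  have mor_id : @is_mor R (unfold i2) (unfold i2) id2 by exact: (@is_mor_id R (unfold i2)).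
  apply: (unfold_mor_unique km2 c2.1 ib2 g2 U2 km2 st2 mor_uv mor_id) => x.
  by rewrite [LHS](induces_beta (v x)) -[RHS]fbv.
Qed.

End Functor.

(** * Rigidification *)

(** [g] kills torsion, so it is constant on the fibres of [q] and may be evaluated on a
    set-theoretic section [r]. *)
Lemma torsion_quot_factor (L Lb A : zmodType) (q : {additive L -> Lb}) (g : {additive L -> A}) :
    torsion_quot q -> tfree [set: A] ->
  exists h : {additive Lb -> A}, forall x, h (q x) = g x.
Proof.
move=> [/choice[r rP] qtor] tfA.
have gE x y : q x = q y -> g x = g y.
  move=> qxy; apply/eqP; rewrite -subr_eq0 -raddfB; apply/eqP.
  have [|k [k_gt0 xk]] := (qtor (x - y)).1; first by rewrite raddfB qxy subrr.
  by apply: (tfA _ k) => //; rewrite -raddfMn xk raddf0.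
have [|h hE] := @additive_of _ _ (g \o r).
  by move=> x y /=; rewrite -raddfB; apply: gE; rewrite raddfB !rP.
by exists h => x; rewrite hE; apply: gE; rewrite rP.
Qed.

Lemma torsion_quot_tfree (L Lb : zmodType) (q : {additive L -> Lb}) :
  torsion_quot q -> tfree [set: Lb].
Proof.
move=> [qsurj qtor] y k _ k_gt0; have [x <-] := qsurj y.
rewrite -raddfMn => /qtor[m [m_gt0 xkm]]; apply/qtor; exists (k * m)%N.
by rewrite muln_gt0 k_gt0 mulrnA.
Qed.

Section Rigidification.
Variables (R : realType) (K : KMfan R) (L Lb : zmodType).
Variables (i : set (VR R (kmN K)) -> kmN K -> L) (q : {additive L -> Lb}).

Lemma compat_comp : compat_fam i -> compat_fam (fun s n => q (i s n)).
Proof.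
move=> [iD iface]; split=> [s Fs x y sx sy|s t Fs ts n tn]; first by rewrite iD// raddfD.
by rewrite (iface s t).
Qed.

Lemma generated_comp : torsion_quot q -> generated i -> generated (fun s n => q (i s n)).
Proof.
move=> [qsurj _] gi P sgP Pi y; have [x <-] := qsurj y.
apply: (gi (q @^-1` P)) => //; split; first by rewrite /= raddf0; apply: subgroup0.
by move=> x1 x2 /= Px1 Px2; rewrite /= raddfB; apply: subgroupB.
Qed.

Lemma imcone_comp s : fR q @` imcone i s = imcone (fun s n => q (i s n)) s.
Proof.
apply/seteqP; split=> [_ [_ [k [c [n [sn sx ->]]]] <-]|_ [k [c [n [sn sx ->]]]]].
  by exists k, c, n.
by exists (fun psi => \sum_j c j * psi (i s (n j))) => //; exists k, c, n.
Qed.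

(** Rigidifying amounts to unfolding with the family [q \o i s], so results on [unfold] for
    compatible families apply to it. *)
Lemma rig_unfold : @rig R (unfold i) Lb q = unfold (fun s n => q (i s n)).
Proof.
rewrite /rig /unfold; congr KMFan.
  apply/seteqP; split=> [_ [_ [[s [Fs ->]] ->]]|_ [s [Fs ->]]].
    by exists s; rewrite imcone_comp.
  by exists (imcone i s); rewrite imcone_comp; split=> //; exists s.
apply/funext => r; apply/seteqP; split=> y /=.
  move=> [_ [_ -> [_ [[s [Fs -> [n [sn ->]]]] ->]]]].
  by exists s; split; [|exact: imcone_comp|exists n].
move=> [s [Fs -> [n [sn ->]]]]; exists (imcone i s); split.
- by exists s.
- by rewrite imcone_comp.
- by exists (i s n); split=> //; exists s; split=> //; exists n.
Qed.

End Rigidification.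

Theorem theorem4p3p6 (R : realType) (K : KMfan R) (L : zmodType)
  (i : set (VR R (kmN K)) -> kmN K -> L) (b : {additive L -> kmN K}) :
  is_KM K -> is_colim i -> is_beta i b ->
  [/\
  (* U(F) is a KM fan and beta : U(F) -> F is semi-tame *)
  is_KM (unfold i) /\ @semitame R (unfold i) K b,
  (* beta is initial among semi-tame morphisms with codomain F *)
  (forall (K' : KMfan R) (f : {additive kmN K' -> kmN K}),
     is_KM K' -> semitame f ->
     (exists g : {additive L -> kmN K'},
        @is_mor R (unfold i) K' g /\ forall y, f (g y) = b y) /\
     (forall g1 g2 : {additive L -> kmN K'},
        @is_mor R (unfold i) K' g1 -> (forall y, f (g1 y) = b y) ->
        @is_mor R (unfold i) K' g2 -> (forall y, f (g2 y) = b y) ->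
        forall y, g1 y = g2 y)),
  (* tameness *)
  (atoroidal K -> tfree [set y | b y = 0] -> @tame R (unfold i) K b),
  (* rigidification of U(F) is the rigidified unfolding *)
  (forall (Lb : zmodType) (q : {additive L -> Lb}), torsion_quot q ->
     @rig R (unfold i) Lb q = unfold (fun s n => q (i s n))) &
  (* lattice case: rigidified unfolding *)
  (tfree [set: kmN K] ->
   forall (Lb : zmodType) (q : {additive L -> Lb}) (bb : {additive Lb -> kmN K}),
     torsion_quot q -> (forall y, bb (q y) = b y) ->
     let ib := fun s n => q (i s n) in
     [/\ lattice_KM (unfold ib) /\ @semitame R (unfold ib) K bb,
         (forall (K' : KMfan R) (f : {additive kmN K' -> kmN K}),
            lattice_KM K' -> semitame f ->
            (exists g : {additive Lb -> kmN K'},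
               @is_mor R (unfold ib) K' g /\ forall y, f (g y) = bb y) /\
            (forall g1 g2 : {additive Lb -> kmN K'},
               @is_mor R (unfold ib) K' g1 -> (forall y, f (g1 y) = bb y) ->
               @is_mor R (unfold ib) K' g2 -> (forall y, f (g2 y) = bb y) ->
               forall y, g1 y = g2 y)),
         (atoroidal K -> @tame R (unfold ib) K bb) &
         (classical_fan K -> classical_fan (unfold ib))])]
  /\
  (* functoriality of F |-> (U(F), beta) *)
  (forall (K1 K2 : KMfan R) (L1 L2 : zmodType)
     (i1 : set (VR R (kmN K1)) -> kmN K1 -> L1) (i2 : set (VR R (kmN K2)) -> kmN K2 -> L2)
     (b1 : {additive L1 -> kmN K1}) (b2 : {additive L2 -> kmN K2}),
     is_KM K1 -> is_colim i1 -> is_beta i1 b1 ->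
     is_KM K2 -> is_colim i2 -> is_beta i2 b2 ->
     forall f : {additive kmN K1 -> kmN K2}, is_mor f ->
       (exists u : {additive L1 -> L2}, induces i1 i2 f u) /\
       (forall u1 u2 : {additive L1 -> L2},
          induces i1 i2 f u1 -> induces i1 i2 f u2 -> forall y, u1 y = u2 y) /\
       (forall u : {additive L1 -> L2}, induces i1 i2 f u ->
          [/\ @is_mor R (unfold i1) (unfold i2) u,
              (forall y, b2 (u y) = f (b1 y)) &
              (semitame f -> @is_iso R (unfold i1) (unfold i2) u)])) /\
  (forall (K1 : KMfan R) (L1 : zmodType)
     (i1 : set (VR R (kmN K1)) -> kmN K1 -> L1) (f : {additive kmN K1 -> kmN K1})
     (u : {additive L1 -> L1}),
     is_KM K1 -> is_colim i1 -> (forall x, f x = x) -> induces i1 i1 f u ->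
     forall y, u y = y) /\
  (forall (K1 K2 K3 : KMfan R) (L1 L2 L3 : zmodType)
     (i1 : set (VR R (kmN K1)) -> kmN K1 -> L1) (i2 : set (VR R (kmN K2)) -> kmN K2 -> L2)
     (i3 : set (VR R (kmN K3)) -> kmN K3 -> L3)
     (f : {additive kmN K1 -> kmN K2}) (g : {additive kmN K2 -> kmN K3})
     (gf : {additive kmN K1 -> kmN K3})
     (u1 : {additive L1 -> L2}) (u2 : {additive L2 -> L3}) (u3 : {additive L1 -> L3}),
     is_KM K1 -> is_colim i1 -> is_KM K2 -> is_colim i2 -> is_KM K3 -> is_colim i3 ->
     is_mor f -> is_mor g -> (forall x, gf x = g (f x)) ->
     induces i1 i2 f u1 -> induces i2 i3 g u2 -> induces i1 i3 gf u3 ->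
     forall y, u3 y = u2 (u1 y)).
Proof.
move=> kmK ci ib; have gi := colim_generated kmK ci.
split; last split; last split.
- split.
  + by split; [exact: (unfold_KM kmK ci.1 ib gi)|exact: (unfold_semitame kmK ci.1 ib)].
  + move=> K' f kmK' stf; split; first exact: (colim_initial kmK ci ib kmK' stf).
    move=> g1 g2 m1 f1 m2 f2; apply: (unfold_mor_unique kmK ci.1 ib gi kmK' kmK stf m1 m2) => y.
    by rewrite f1 f2.
  + by move=> atK tfb; apply: (unfold_tame kmK ci.1 ib).
  + by move=> Lb q _; apply: rig_unfold.
  + move=> tfN Lb q bb tq bbq ib'.
    (* The family [ib'] is compatible, split by [bb] and generating, which is what the geometry of
       the unfolding requires. *)
    have ci' : compat_fam ib' by exact: compat_comp ci.1.
    have ibb : is_beta ib' bb by move=> s n Fs sn; rewrite bbq ib.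
    have gi' : generated ib' by exact: generated_comp.
    have tfLb := torsion_quot_tfree tq.
    have U := unfold_KM kmK ci' ibb gi'.
    split.
    * by split; [split|exact: (unfold_semitame kmK ci' ibb)].
    * move=> K' f [kmK' tfK'] stf; split; last first.
        move=> g1 g2 m1 f1 m2 f2.
        apply: (unfold_mor_unique kmK ci' ibb gi' kmK' kmK stf m1 m2) => y.
        by rewrite f1 f2.
      (* The colimit gives a lift on [L]; it descends to [Lb] since [kmN K'] is torsion-free. *)
      have [h [fh hi]] := colim_lift kmK ci ib kmK' stf.
      have [g gq] := torsion_quot_factor h tq tfK'.
      have fg y : f (g y) = bb y by have [x <-] := tq.1 y; rewrite gq fh bbq.
      exists g; split=> //; apply: (unfold_mor kmK ibb kmK' stf fg) => s n Fs sn.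
      by rewrite gq; apply: hi.
    * move=> atK; apply: (unfold_tame kmK ci' ibb atK) => x k _; exact: tfLb.
    * exact: (unfold_classical kmK ci' ibb gi' tfLb).
- move=> K1 K2 L1 L2 i1 i2 b1 b2 km1 c1 ib1 km2 c2 ib2 f morf.
  split; first exact: (induces_ex km1 km2 c1 c2 morf).
  split; first by move=> u1 u2; apply: (induces_unique km1 c1 morf).
  move=> u ui; split.
  + exact: (induces_mor km1 km2 c1 ib1 ib2 morf ui).
  + exact: (induces_beta km1 c1 ib1 ib2 morf ui).
  + exact: (induces_iso km1 km2 c1 c2 ib1 ib2 morf ui).
- move=> K1 L1 i1 f u km1 c1 f_id ui.
  apply: (@generated_eq _ _ _ _ i1 u idfun (colim_generated km1 c1)) => s n Fs sn.
  rewrite (ui s s)// ?f_id//.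
    by move=> _ [x sx <-]; rewrite fR_id.
  by move=> _ [x sx <-]; rewrite f_id.
- move=> K1 K2 K3 L1 L2 L3 i1 i2 i3 f g gf u1 u2 u3 km1 c1 km2 c2 km3 c3 morf morg gfE ui1 ui2 ui3.
  apply: (@generated_eq _ _ _ _ i1 u3 (u2 \o u1) (colim_generated km1 c1)) => s n Fs sn.
  (* Here [t] receives [s] and [r] receives [t], so [r] receives [s] under [gf]; both sides become
     [i3 r (g (f n))]. *)
  have [t [Ft st Lt]] := morf s Fs; have [r [Fr tr Lr]] := morg t Ft.
  have tn : Lat K2 t (f n) by apply: Lt; exists n.
  rewrite /= (ui1 s t)// (ui2 t r)// -gfE (ui3 s r)// => _ [x sx <-].
    rewrite -(fR_comp (fun x => esym (gfE x))); apply: tr; exists (fR f x) => //.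
    by apply: st; exists x.
  by rewrite gfE; apply: Lr; exists (f x) => //; apply: Lt; exists x.
Qed.
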